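(* Let $\mu\in\mathcal P$ and let the stabilization parameter be $\rho:=C_{k,\mathrm{ovl}}\cdot\kappa$. Then the two-scale bilinear form $\mathfrak B_\mu$ is $|||\cdot|||_{a,\mu}$-$|||\cdot|||_1$-continuous and inf-sup stable, with the following bounds on the respective constants: $$\sup_{0\ne\mathfrak u\in\mathfrak V}\ \sup_{0\ne\mathfrak v\in\mathfrak V}\frac{\mathfrak B_\mu(\mathfrak u,\mathfrak v)}{|||\mathfrak u|||_{a,\mu}\cdot|||\mathfrak v|||_1}\le\beta^{1/2}\qquad\text{and}\qquad\inf_{0\ne\mathfrak u\in\mathfrak V}\ \sup_{0\ne\mathfrak v\in\mathfrak V}\frac{\mathfrak B_\mu(\mathfrak u,\mathfrak v)}{|||\mathfrak u|||_{a,\mu}\cdot|||\mathfrak v|||_1}\ge\gamma_k/\sqrt5.$$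
   Context: **Problem.** $\mathcal P\subset\mathbb R^p$ is a parameter set, $\Omega\subset\mathbb R^d$ a bounded Lipschitz domain, $V:=H^1_0(\Omega)$, and for each $\mu\in\mathcal P$, $A_\mu\in L^\infty(\Omega,\mathbb R^{d\times d})$ is symmetric with $\alpha|\xi|^2\le\xi^TA_\mu(x)\xi\le\beta|\xi|^2$ for all $\mu\in\mathcal P$, $x\in\Omega$, $\xi\in\mathbb R^d$, where $0<\alpha\le\beta<\infty$ are fixed; $\kappa:=\beta/\alpha$. Set $a_\mu(u,v):=\int_\Omega (A_\mu\nabla u)\cdot\nabla v\,dx$ and for $T\subseteq\Omega$ let $a_\mu^T(u,v):=\int_T(A_\mu\nabla u)\cdot\nabla v\,dx$. Norms on $V$: $\|v\|_1^2:=\int_\Omega|\nabla v|^2dx$, $\|v\|_{a,\mu}^2:=\int_\Omega|A_\mu^{1/2}\nabla v|^2dx$. **Discretization.** $V_h\subset V$ is a (finite-dimensional) conforming finite-element space over a shape-regular mesh $\mathcal T_h$ of $\Omega$; $\mathcal T_H=\{T_1,\dots,T_{|\mathcal T_H|}\}$ is a coarse mesh aligned with $\mathcal T_h$; $V_H:=V_h\cap\mathcal P_1(\mathcal T_H)\neq\{0\}$, where $\mathcal P_1(\mathcal T_H)$ denotes the continuous, $\mathcal T_H$-piecewise affine functions. For $\omega\subseteq\Omega$, $U_0(\omega):=\omega$ and $U_{k+1}(\omega):=\operatorname{Int}\big(\overline{\bigcup\{T\in\mathcal T_H: \overline{U_k(\omega)}\cap\overline T\ne\emptyset\}}\big)$.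 Fix an integer $k\ge0$ and set $C_{k,\mathrm{ovl}}:=\max_{x\in\Omega}\#\{T\in\mathcal T_H: x\in U_k(T)\}$. $\mathcal I_H:V_h\to V_H$ is linear with $\mathcal I_H(v_H)=v_H$ for $v_H\in V_H$ and $\|\mathcal I_H(v_h)\|_1\le C_{\mathcal I_H}\|v_h\|_1$ for $v_h\in V_h$. **Correctors.** $V_h^{\mathrm f}:=\ker\mathcal I_H$ and $V^{\mathrm f}_{h,k,T}:=V_h^{\mathrm f}\cap H^1_0(U_k(T))$ (functions extended by zero). For $v_h\in V_h$, $\mathcal Q^T_{k,\mu}(v_h)\in V^{\mathrm f}_{h,k,T}$ is the solution of $a_\mu(\mathcal Q^T_{k,\mu}(v_h),v^{\mathrm f})=a_\mu^T(v_h,v^{\mathrm f})$ for all $v^{\mathrm f}\in V^{\mathrm f}_{h,k,T}$. Set $\mathcal Q_{k,\mu}:=\sum_{T\in\mathcal T_H}\mathcal Q^T_{k,\mu}$. **Inf-sup constant of the PG--LOD.** $$\gamma_k:=\inf_{0\ne w_H\in V_H}\sup_{0\ne v_H\in V_H}\frac{a_\mu(w_H-\mathcal Q_{k,\mu}(w_H),v_H)}{\|w_H-\mathcal Q_{k,\mu}(w_H)\|_{a,\mu}\,\|v_H\|_1}.$$ Standing assumptions: $\gamma_k>0$ and $\gamma_k\le\alpha^{1/2}$. **Two-scale objects.** $\mathfrak V:=V_H\oplus V^{\mathrm f}_{h,k,T_1}\oplus\cdots\oplus V^{\mathrm f}_{h,k,T_{|\mathcal T_H|}}$. For $\mathfrak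 u=(u_H,u^{\mathrm f}_{T_1},\dots,u^{\mathrm f}_{T_{|\mathcal T_H|}})$, $\mathfrak v=(v_H,v^{\mathrm f}_{T_1},\dots,v^{\mathrm f}_{T_{|\mathcal T_H|}})$ in $\mathfrak V$ and stabilization parameter $\rho$, $$\mathfrak B_\mu(\mathfrak u,\mathfrak v):=a_\mu\Big(u_H-\sum_{T\in\mathcal T_H}u^{\mathrm f}_T,\,v_H\Big)+\rho^{1/2}\sum_{T\in\mathcal T_H}\big(a_\mu(u_T^{\mathrm f},v_T^{\mathrm f})-a_\mu^T(u_H,v_T^{\mathrm f})\big),$$ $$|||\mathfrak u|||_1^2:=\|u_H\|_1^2+\sum_{T\in\mathcal T_H}\|u_T^{\mathrm f}\|_1^2,\qquad |||\mathfrak u|||_{a,\mu}^2:=\Big\|u_H-\sum_{T\in\mathcal T_H}u_T^{\mathrm f}\Big\|_{a,\mu}^2+\rho\sum_{T\in\mathcal T_H}\|\mathcal Q^T_{k,\mu}(u_H)-u_T^{\mathrm f}\|_{a,\mu}^2.$$ *)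

(* Defs.v *)
From HB Require Import structures.
From mathcomp Require Import all_boot all_order all_algebra.
From mathcomp Require Import all_classical all_reals all_analysis.

Set Implicit Arguments.
Unset Strict Implicit.
Unset Printing Implicit Defensive.

Import Order.TTheory GRing.Theory Num.Theory.
Import numFieldNormedType.Exports.

Local Open Scope classical_set_scope.
Local Open Scope ring_scope.

Section row_measurable.
Context (R : realType) (n : nat).

Let coords (i : 'I_n) (x : 'rV[R]_n) : measurableTypeR R := x ord0 i.

Let row_set0 : g_sigma_preimage coords set0.
Proof. exact: sigma_algebra0. Qed.

Let row_setC A : g_sigma_preimage coords A -> g_sigma_preimage coords (~` A).
Proof. exact: sigma_algebraC. Qed.

Let row_bigcup (F : (set 'rV[R]_n)^nat) :
  (forall i, g_sigma_preimage coords (F i)) ->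
  g_sigma_preimage coords (\bigcup_i (F i)).
Proof. exact: sigma_algebra_bigcup. Qed.

HB.instance Definition _ := @isMeasurable.Build
  (measure_tuple_display default_measure_display)
  'rV[R]_n (g_sigma_preimage coords) row_set0 row_setC row_bigcup.

Lemma measurable_coord (i : 'I_n) :
  measurable_fun setT (fun x : 'rV[R]_n => x ord0 i : measurableTypeR R).
Proof.
move=> _ Y mY; rewrite setTI; apply: sub_sigma_algebra => /=.
rewrite -bigcup_seq/=; exists i => /=; first by rewrite mem_index_enum.
by exists Y => //; rewrite setTI.
Qed.

Lemma measurable_fun_rowP d (T : measurableType d) (f : T -> 'rV[R]_n) :
  (forall i, measurable_fun setT (fun t => f t ord0 i : measurableTypeR R)) ->
  measurable_fun setT f.
Proof.
move=> mf _ A mA; rewrite setTI.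
suff : preimage_set_system setT f (g_sigma_preimage coords) `<=` measurable.
  by apply; exists A => //; rewrite setTI.
rewrite -g_sigma_preimage_comp.
apply: smallest_sub; first exact: sigma_algebra_measurable.
move=> B; rewrite -bigcup_seq => -[i _ [C mC <-]].
exact: mf.
Qed.

End row_measurable.

Section lebesgue_row.
Context (R : realType).
Local Open Scope ereal_scope.

Definition cons_row n (p : measurableTypeR R * 'rV[R]_n) : 'rV[R]_n.+1 :=
  row_mx (p.1)%:M p.2.

(* Lebesgue measure on R^n, by Cavalieri's principle: the measure of A is the
   integral over t of the measure of the slice of A with first coordinate t. *)
Fixpoint lebesgue_row n : set 'rV[R]_n -> \bar R :=
  match n return set 'rV[R]_n -> \bar R with
  | 0 => \d_(0%R : 'rV[R]_0)
  | n.+1 => fun A => \int[lebesgue_measure]_t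
                       lebesgue_row [set y | A (cons_row (t, y))]
  end.

Section step.
Context (n : nat) (m : {sigma_finite_measure set 'rV[R]_n -> \bar R}).

Let uncons_rowK : cancel (@cons_row n) (fun x : 'rV[R]_n.+1 =>
  (x ord0 ord0 : measurableTypeR R, rsubmx (x : 'rV_(1 + n)))).
Proof.
move=> [t y]; rewrite /cons_row/= row_mxKr; congr pair.
rewrite (_ : (ord0 : 'I_n.+1) = lshift n (ord0 : 'I_1)); last exact/val_inj.
by rewrite (row_mxEl (t%:M : 'rV_1) y) mxE eqxx.
Qed.

Let measurable_cons_row : measurable_fun setT (@cons_row n).
Proof.
apply: measurable_fun_rowP => i.
rewrite -[i]/(i : 'I_(1 + n)); case: (split_ordP (i : 'I_(1 + n))) => j ->.
  rewrite (_ : (fun _ => _) = fst); first exact: measurable_fst.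
  apply/funext => -[t y]; rewrite /cons_row/=.
  by rewrite (row_mxEl (t%:M : 'rV_1) y) mxE (ord1 j).
rewrite (_ : (fun _ => _) = (fun y : 'rV[R]_n => y ord0 j) \o snd).
  by apply: measurableT_comp; [exact: measurable_coord|exact: measurable_snd].
apply/funext => -[t y]; rewrite /cons_row/=.
exact: (row_mxEr (t%:M : 'rV_1) y).
Qed.

Let measurable_uncons_row : measurable_fun setT (fun x : 'rV[R]_n.+1 =>
  (x ord0 ord0 : measurableTypeR R, rsubmx (x : 'rV_(1 + n)))).
Proof.
apply: measurable_fun_pair; first exact: measurable_coord.
apply: measurable_fun_rowP => i.
rewrite (_ : (fun _ => _) = fun x : 'rV[R]_n.+1 => x ord0 (rshift 1 i)).
  exact: measurable_coord.
by apply/funext => x; rewrite mxE.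
Qed.

Definition lebesgue_step (A : set 'rV[R]_n.+1) : \bar R :=
  (lebesgue_measure \x m) (@cons_row n @^-1` A).

Let step0 : lebesgue_step set0 = 0.
Proof. by rewrite /lebesgue_step preimage_set0 measure0. Qed.

Let step_ge0 A : 0 <= lebesgue_step A.
Proof. exact: measure_ge0. Qed.

Let step_sigma_additive : semi_sigma_additive lebesgue_step.
Proof.
have mpre B : measurable B -> measurable (@cons_row n @^-1` B).
  by move=> mB; rewrite -[X in measurable X]setTI; exact: measurable_cons_row.
move=> F mF tF mUF; rewrite /lebesgue_step preimage_bigcup.
apply: measure_semi_sigma_additive.
- by move=> k; exact: mpre.
- apply/trivIsetP => /= i j _ _ ij; rewrite -preimage_setI.
  by move/trivIsetP : tF => /(_ _ _ _ _ ij) ->//; rewrite preimage_set0.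
- by rewrite -preimage_bigcup; exact: mpre.
Qed.

HB.instance Definition _ := isMeasure.Build _ _ _ lebesgue_step
  step0 step_ge0 step_sigma_additive.

Let step_sigma_finite : sigma_finite setT lebesgue_step.
Proof.
have /sigma_finiteP[F [FT ndF Foo]] := sigma_finiteT (@lebesgue_measure R).
have /sigma_finiteP[G [GT ndG Goo]] := sigma_finiteT m.
exists (fun k => (fun x : 'rV[R]_n.+1 =>
  (x ord0 ord0 : measurableTypeR R, rsubmx (x : 'rV_(1 + n)))) @^-1`
  (F k `*` G k)).
  apply/esym; rewrite -subTset => x _.
  have [k _ Fk] : (\bigcup_k F k) (x ord0 ord0) by rewrite -FT.
  have [l _ Gl] : (\bigcup_k G k) (rsubmx (x : 'rV_(1 + n))) by rewrite -GT.
  exists (maxn k l) => //; split => /=.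
    by move: Fk; exact/subsetPset/ndF/leq_maxl.
  by move: Gl; exact/subsetPset/ndG/leq_maxr.
move=> k; have [mF Fk] := Foo k; have [mG Gk] := Goo k; split.
  rewrite -[X in measurable X]setTI; apply: measurable_uncons_row => //.
  exact: measurableX.
rewrite /lebesgue_step -comp_preimage (_ : _ \o _ = id) ?preimage_id.
  by rewrite product_measure1E// lte_mul_pinfty// ge0_fin_numE.
by apply/funext => p /=; exact: uncons_rowK.
Qed.

HB.instance Definition _ := Measure_isSigmaFinite.Build _ _ _ lebesgue_step
  step_sigma_finite.

End step.

Let lebesgue_rowP n : exists m : {sigma_finite_measure set 'rV[R]_n -> \bar R},
  m = @lebesgue_row n :> (set 'rV[R]_n -> \bar R).
Proof.
elim: n => [|n [m mE]]; first by exists \d_(0%R : 'rV[R]_0).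
exists (lebesgue_step m); apply/funext => A /=; rewrite -mE.
rewrite /lebesgue_step /product_measure1; apply: eq_integral => t _ /=.
by congr (m _); apply/seteqP; split => y; rewrite /xsection/= inE.
Qed.

Section instance.
Context (n : nat).

Let row0 : @lebesgue_row n set0 = 0.
Proof. by have [m <-] := lebesgue_rowP n; rewrite measure0. Qed.

Let row_ge0 A : 0 <= @lebesgue_row n A.
Proof. by have [m <-] := lebesgue_rowP n; exact: measure_ge0. Qed.

Let row_sigma_additive : semi_sigma_additive (@lebesgue_row n).
Proof.
by have [m <-] := lebesgue_rowP n; exact: measure_semi_sigma_additive.
Qed.

HB.instance Definition _ := isMeasure.Build _ _ _ (@lebesgue_row n)
  row0 row_ge0 row_sigma_additive.

Let row_sigma_finite : sigma_finite setT (@lebesgue_row n).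
Proof. by have [m <-] := lebesgue_rowP n; exact: sigma_finiteT. Qed.

HB.instance Definition _ := Measure_isSigmaFinite.Build _ _ _ (@lebesgue_row n)
  row_sigma_finite.

End instance.

End lebesgue_row.

Section euclidean.
Context (R : realType) (d : nat).
Implicit Types (x y xi : 'rV[R]_d) (B : 'M[R]_d).

Definition dotv x y : R := (x *m y^T) 0 0.

(* The library norm on 'rV[R]_d is the sup norm. *)
Definition enorm x : R := Num.sqrt (dotv x x).

(* The matrix-vector product B xi; points and gradients are rows. *)
Definition appmx B xi : 'rV[R]_d := xi *m B^T.

(* B^(1/2): the symmetric positive semidefinite square root (junk value 0 if
   there is none). *)
Definition sqrtmx B : 'M[R]_d :=
  xget 0 [set C | [/\ C^T = C, forall xi, 0 <= dotv (appmx C xi) xi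
                    & C *m C = B]].

End euclidean.

(* The boundary of the open set D is, near each of its points and after a
   rigid change of coordinates, the graph of a Lipschitz function, with D on
   one side of it. *)
Definition lipschitz_boundary (R : realType) (d : nat)
    (D : set 'rV[R]_d.+1) : Prop :=
  forall x0, (closure D `\` D) x0 ->
  exists (r : R) (O : 'M[R]_d.+1) (g : 'rV[R]_d -> R) (L : R),
    [/\ 0 < r, O *m O^T = 1%:M,
        forall y z, `|g y - g z| <= L * enorm (y - z)
      & forall x, enorm (x - x0) < r ->
          D x <-> g (col' ord0 (x *m O)) < (x *m O) 0 ord0].

Definition bounded_lipschitz_domain (R : realType) (d : nat)
    (D : set 'rV[R]_d.+1) : Prop :=
  [/\ open D, connected D, D !=set0, bounded_set D & lipschitz_boundary D].

Section sobolev.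
Context (R : realType) (d' : nat).
Let d := d'.+1.
Let F := 'rV[R]_d -> R.
Let lambda := @lebesgue_row R d.
Implicit Types (u v phi : F) (g : 'rV[R]_d -> 'rV[R]_d) (w : set 'rV[R]_d).

Definition grad u (x : 'rV[R]_d) : 'rV[R]_d :=
  \row_(i < d) ('D_(delta_mx 0 i : 'rV[R]_d) u x).

Definition iter_partial (s : seq 'I_d) u : F :=
  foldr (fun i f => 'D_(delta_mx 0 i : 'rV[R]_d) f) u s.

(* C^infinity on the open set w *)
Definition smooth_on w u : Prop :=
  forall s x, w x -> differentiable (iter_partial s u) x.

(* C_c^infinity(w) *)
Definition test_fun w phi : Prop :=
  smooth_on setT phi /\
  exists K, [/\ compact K, K `<=` w & forall x, ~ K x -> phi x = 0].

Definition L2 u : Prop :=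
  measurable_fun setT u /\ (\int[lambda]_x ((u x) ^+ 2)%:E < +oo)%E.

(* u, extended by zero outside w, belongs to H^1_0(w), the closure of
   C_c^infinity(w) in the H^1 norm, and has weak gradient g. *)
Definition H10_grad w u g : Prop :=
  [/\ L2 u, forall i, L2 (fun x => g x 0 i)
    & exists phi : nat -> F,
      [/\ forall n, test_fun w (phi n),
          (\int[lambda]_x ((phi n x - u x) ^+ 2)%:E)%E
             @[n --> \oo] --> 0%E
        & (\int[lambda]_x ((enorm (grad (phi n) x - g x)) ^+ 2)%:E)%E
             @[n --> \oo] --> 0%E]].

(* Membership in H^1_0(w) of a function whose pointwise gradient is its weak
   gradient.  This holds for the H^1-conforming finite-element functions
   below, whose weak gradient is the elementwise classical one. *)
Definition H10 w : set F := [set u | H10_grad w u (grad u)].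

End sobolev.

Section mesh.
Context (R : realType) (d' : nat).
Let d := d'.+1.
Let F := 'rV[R]_d -> R.
Let lambda := @lebesgue_row R d.
Implicit Types (Omega w : set 'rV[R]_d).

(* Elements are open, so that H^1_0(T) and interiors need no adjustment.  No
   particular shape (simplices, parallelepipeds, curved cells) is imposed. *)
Definition is_mesh Omega N (T : 'I_N -> set 'rV[R]_d) : Prop :=
  [/\ forall i, [/\ open (T i), connected (T i), T i !=set0, T i `<=` Omega
                  & lambda (closure (T i) `\` T i) = 0%E],
      forall i j, i != j -> T i `&` T j = set0
    & closure Omega = \bigcup_i closure (T i)].

(* Ratio of the diameter to the radius of an inscribed ball at most sigma. *)
Definition shape_regular (sigma : R) N (T : 'I_N -> set 'rV[R]_d) : Prop :=
  forall i, exists (c : 'rV[R]_d) (r : R),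
    [/\ 0 < r, forall x, enorm (x - c) < r -> T i x
      & forall x y, T i x -> T i y -> enorm (x - y) <= sigma * r].

(* The coarse mesh TH is resolved by the fine mesh Th. *)
Definition aligned Nh NH (Th : 'I_Nh -> set 'rV[R]_d)
    (TH : 'I_NH -> set 'rV[R]_d) : Prop :=
  forall i, exists j, Th i `<=` TH j.

Definition fin_dim_space (V : set F) : Prop :=
  exists (m : nat) (b : 'I_m -> F),
    V = [set u | exists c : 'I_m -> R,
                   u = fun x => \sum_(i < m) c i * b i x].

(* Finite-element functions are represented by their continuous
   representative, extended by zero outside Omega; shape functions may be
   arbitrary smooth (e.g. polynomial, or mapped polynomial) functions. *)
Definition conforming_fe_space Omega N (T : 'I_N -> set 'rV[R]_d)
    (V : set F) : Prop :=
  [/\ fin_dim_space V, V `<=` H10 Omega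
    & forall u, V u -> [/\ continuous u, forall x, ~ Omega x -> u x = 0
                         & forall i, smooth_on (T i) u]].

(* Continuous functions on the closure of Omega, affine on each element. *)
Definition P1 Omega N (T : 'I_N -> set 'rV[R]_d) : set F :=
  [set u | {within closure Omega, continuous u} /\
           forall i, exists (b : 'rV[R]_d) (c : R),
             forall x, T i x -> u x = dotv b x + c].

(* U_k(w), the k-layer neighbourhood of w *)
Fixpoint patch N (T : 'I_N -> set 'rV[R]_d) (k : nat) w : set 'rV[R]_d :=
  match k with
  | 0 => w
  | k.+1 => interior (closure
      (\bigcup_(i in [set i | (closure (patch T k w) `&` closure (T i))
                                !=set0]) T i))
  end.

(* max over x in Omega of the number of elements T_i with x in U_k(T_i): the
   maximum runs over the index sets S that arise from some x. *)
Definition C_ovl Omega N (T : 'I_N -> set 'rV[R]_d) (k : nat) : nat :=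
  \max_(S : {set 'I_N} |
      `[< exists2 x, Omega x & forall i, i \in S <-> patch T k (T i) x >]) #|S|.

End mesh.

Section inf_sup.
Context (R : realType) (U W : Type).
Implicit Types (D : set U) (E : set W) (q : U -> W -> R).
Local Open Scope ereal_scope.

Definition sup_sup D E q : \bar R :=
  ereal_sup [set ereal_sup [set (q u w)%:E | w in E] | u in D].

Definition inf_sup D E q : \bar R :=
  ereal_inf [set ereal_sup [set (q u w)%:E | w in E] | u in D].

End inf_sup.

Section problem.
Context (R : realType) (d' : nat).
Let d := d'.+1.
Let F := 'rV[R]_d -> R.
Let lambda := @lebesgue_row R d.
Implicit Types (u v : F) (T : set 'rV[R]_d).

Definition admissible_coefficient (Omega : set 'rV[R]_d) (alpha beta : R)
    (A : 'rV[R]_d -> 'M[R]_d) : Prop :=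
  [/\ forall i j, measurable_fun Omega (fun x => A x i j),
      exists M : R, {ae lambda, forall x, Omega x ->
                       forall i j, `|A x i j| <= M},
      forall x, Omega x -> (A x)^T = A x
    & forall x, Omega x -> forall xi,
        alpha * enorm xi ^+ 2 <= dotv xi (appmx (A x) xi) <=
        beta * enorm xi ^+ 2].

(* a^T(u,v); the form a is the case T = Omega *)
Definition form (A : 'rV[R]_d -> 'M[R]_d) T u v : R :=
  \int[lambda]_(x in T) dotv (appmx (A x) (grad u x)) (grad v x).

Definition norm1 (Omega : set 'rV[R]_d) v : R :=
  Num.sqrt (\int[lambda]_(x in Omega) enorm (grad v x) ^+ 2).

Definition norma (A : 'rV[R]_d -> 'M[R]_d) (Omega : set 'rV[R]_d) v : R :=
  Num.sqrt (\int[lambda]_(x in Omega)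
              enorm (appmx (sqrtmx (A x)) (grad v x)) ^+ 2).

Definition interpolation (Omega : set 'rV[R]_d) (Vh VH : set F)
    (C : R) (IH : F -> F) : Prop :=
  [/\ forall v, Vh v -> VH (IH v),
      forall (c : R) u v, Vh u -> Vh v -> IH (c *: u + v) = c *: IH u + IH v,
      forall v, VH v -> IH v = v
    & forall v, Vh v -> norm1 Omega (IH v) <= C * norm1 Omega v].

End problem.

Section lod.
Context (R : realType) (d' : nat).
Let d := d'.+1.
Let F := 'rV[R]_d -> R.
Context (Omega : set 'rV[R]_d) (N : nat) (TH : 'I_N -> set 'rV[R]_d).
Context (Vh : set F) (IH : F -> F) (k : nat).
Context (A : 'rV[R]_d -> 'M[R]_d).

Let a := form A Omega.
Let aT (i : 'I_N) := form A (TH i).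

Definition coarse_space : set F := Vh `&` P1 Omega TH.
Let VH := coarse_space.

Definition fine_space (i : 'I_N) : set F :=
  [set v | [/\ Vh v, IH v = 0 & H10 (patch TH k (TH i)) v]].

Definition corrector_T (i : 'I_N) (v : F) : F :=
  xget 0 [set q | fine_space i q /\
                  forall w, fine_space i w -> a q w = aT i v w].

Definition corrector (v : F) : F := \sum_(i < N) corrector_T i v.

Definition gamma : \bar R :=
  inf_sup (VH `\ 0) (VH `\ 0) (fun w v =>
    a (w - corrector w) v /
    (norma A Omega (w - corrector w) * norm1 Omega v)).

(* A two-scale function is a pair of a coarse part and a family of fine parts
   indexed by the coarse elements. *)
Definition two_scale_space : set (F * ('I_N -> F)) :=
  [set u | VH u.1 /\ forall i, fine_space i (u.2 i)].

Implicit Types u v : F * ('I_N -> F).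

Definition two_scale_form (rho : R) u v : R :=
  a (u.1 - \sum_(i < N) u.2 i) v.1 +
  Num.sqrt rho * \sum_(i < N) (a (u.2 i) (v.2 i) - aT i u.1 (v.2 i)).

Definition two_scale_norm1 u : R :=
  Num.sqrt (norm1 Omega u.1 ^+ 2 + \sum_(i < N) norm1 Omega (u.2 i) ^+ 2).

Definition two_scale_norma (rho : R) u : R :=
  Num.sqrt (norma A Omega (u.1 - \sum_(i < N) u.2 i) ^+ 2 +
            rho * \sum_(i < N) norma A Omega (corrector_T i u.1 - u.2 i) ^+ 2).

Definition two_scale_quotient (rho : R) u v : R :=
  two_scale_form rho u v / (two_scale_norma rho u * two_scale_norm1 v).

End lod.

(* Main.v *)
Require Import Defs.
From HB Require Import structures.
From mathcomp Require Import all_boot all_order all_algebra.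
From mathcomp Require Import all_classical all_reals all_analysis.
From mathcomp Require Import measurable_realfun ring lra.
From mathcomp Require Import complex.

(** Write e_T = Q_T u_H - u_T for the defects of a two-scale function, f for
    their sum, w = u_H - Q u_H and z = u_H - (sum of the u_T), so that z = w + f,
    and let E2 = rho (sum of |e_T|_a^2).  By the corrector equations, the form is
    a (z, v_H) - sqrt rho (sum of a (e_T, v_T)), and the trial norm is
    sqrt (|z|_a^2 + E2).  Continuity is then Cauchy-Schwarz together with
    a <= beta |.|_1^2 ([tsform_continuous]).

    For the inf-sup bound, test with v_T = - sqrt (alpha rho) e_T and with a
    coarse v_H that is the multiple P / |v|_1, P = a (z, v) / (sqrt alpha |v|_1),
    of a function v that nearly realizes gamma at w.  The form equals
    sqrt alpha (P^2 + E2), and the test norm is at most sqrt (P^2 + E2), so that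
    the claim is gamma^2 (|z|_a^2 + E2) <= 5 alpha (P^2 + E2).  As
    gamma^2 <= alpha, only |z|_a has to be bounded.  At most C_ovl of the defects
    are nonzero near a point, hence |f|_a^2 <= C_ovl (sum of |e_T|_a^2)
    ([form_overlap]), and the choice of rho makes
    |f|_a |v|_a <= sqrt (alpha E2) |v|_1.  Since z is a perturbation by f of w,
    whose angle with v is controlled by gamma, a plane-geometry inequality
    ([two_scale_key]) gives gamma |z|_a <= sqrt (2 alpha) (|P| + sqrt E2) up to a
    factor close to 1, and 2 (X + S)^2 + S^2 <= 5 (X^2 + S^2) with room to spare
    ([coarse_test], [tsform_infsup]).

    This argument needs a to be an inner product on the finite-element space,
    definite in particular, the correctors to exist, and the energy norm to be
    the one defined through the matrix square root.  Gradients here are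
    pointwise, hence additive only off the boundaries of the elements, which are
    null sets ([regular_ae], [form_inner]).  Definiteness holds because a continuous
    function with elementwise zero gradient has a finite range ([fe_definite]),
    the correctors exist by a finite-dimensional representation theorem
    ([riesz_finite], [corrector_TP]), and square roots by the spectral theorem
    ([psd_sqrt_exists]).  *)

Set Implicit Arguments.
Unset Strict Implicit.
Unset Printing Implicit Defensive.

Import Order.TTheory GRing.Theory Num.Theory.
Import numFieldNormedType.Exports.

Local Open Scope classical_set_scope.
Local Open Scope ring_scope.

(* Two names that also belong to notions of the imported files. *)
Local Notation form := Defs.form.
Local Notation patch := Defs.patch.

(** * Inner products on subspaces *)

(** The discrete spaces are sets of functions, so linearity and positivity are
    only asked on a set. *)
Definition lin_subspace (R : realType) (F : lmodType R) (S : set F) : Prop :=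
  S 0 /\ forall c u v, S u -> S v -> S (c *: u + v).

Definition linear_on (R : realType) (F : lmodType R) (S : set F) (l : F -> R) :=
  forall c u v, S u -> S v -> l (c *: u + v) = c * l u + l v.

Record inner_on (R : realType) (F : lmodType R) (S : set F) (a : F -> F -> R)
    : Prop := InnerOn {
  inner_sub : lin_subspace S;
  inner_lin : forall u, S u -> linear_on S (a^~ u);
  inner_sym : forall u v, S u -> S v -> a u v = a v u;
  inner_ge0 : forall u, S u -> 0 <= a u u }.

Section subspace_theory.
Context (R : realType) (F : lmodType R) (S : set F).
Hypothesis sS : lin_subspace S.

Lemma subspaceD u v : S u -> S v -> S (u + v).
Proof. by move=> Su Sv; rewrite -[u]scale1r; apply: sS.2. Qed.

Lemma subspaceZ c u : S u -> S (c *: u).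
Proof. by move=> Su; rewrite -[_ *: _]addr0; apply: sS.2 => //; exact: sS.1. Qed.

Lemma subspaceB u v : S u -> S v -> S (u - v).
Proof. by move=> Su Sv; rewrite addrC -scaleN1r; apply: sS.2. Qed.

Lemma subspace_sum n (f : 'I_n -> F) : (forall i, S (f i)) -> S (\sum_(i < n) f i).
Proof.
by move=> Sf; elim/big_ind: _ => //; [exact: sS.1|exact: subspaceD].
Qed.

Section linear.
Variables (l : F -> R).
Hypothesis ll : linear_on S l.

Lemma linear_on0 : l 0 = 0.
Proof.
have := ll 1 sS.1 sS.1; rewrite scale1r addr0 mul1r => /esym/eqP.
by rewrite -subr_eq0 addrK => /eqP.
Qed.

Lemma linear_onD u v : S u -> S v -> l (u + v) = l u + l v.
Proof. by move=> Su Sv; rewrite -[u in LHS]scale1r ll// mul1r. Qed.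

Lemma linear_onZ c u : S u -> l (c *: u) = c * l u.
Proof.
move=> Su; rewrite -[c *: u]addr0 ll ?linear_on0 ?addr0//; exact: sS.1.
Qed.

Lemma linear_onB u v : S u -> S v -> l (u - v) = l u - l v.
Proof.
by move=> Su Sv; rewrite addrC -scaleN1r ll// mulN1r addrC.
Qed.

Lemma linear_on_sum n (f : 'I_n -> F) : (forall i, S (f i)) ->
  l (\sum_(i < n) f i) = \sum_(i < n) l (f i).
Proof.
move=> Sf; elim: n f Sf => [|n IH] f Sf.
  by rewrite !big_ord0 linear_on0.
rewrite !big_ord_recr/= linear_onD// ?IH//.
by elim/big_ind: _ => //; [exact: sS.1|exact: subspaceD].
Qed.

End linear.
End subspace_theory.

Lemma sub_inner (R : realType) (F : lmodType R) (S S' : set F) a :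
  lin_subspace S' -> S' `<=` S -> inner_on S a -> inner_on S' a.
Proof.
move=> sS' SS' [sS lS cS pS]; split => //.
- by move=> u Su c v w Sv Sw; apply: lS; apply: SS'.
- by move=> u v Su Sv; apply: cS; apply: SS'.
- by move=> u Su; apply: pS; apply: SS'.
Qed.

Section inner_theory.
Context (R : realType) (F : lmodType R) (S : set F) (a : F -> F -> R).
Hypothesis ia : inner_on S a.
Let sS := inner_sub ia.

Lemma inner_linr u : S u -> linear_on S (a u).
Proof.
move=> Su c v w Sv Sw; rewrite (inner_sym ia) ?(inner_lin ia)//; last exact: sS.2.
by rewrite (inner_sym ia Su Sv) (inner_sym ia Su Sw).
Qed.

Lemma innerDl u v w : S u -> S v -> S w -> a (u + v) w = a u w + a v w.
Proof. by move=> Su Sv Sw; rewrite (linear_onD (inner_lin ia Sw)). Qed.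

Lemma innerDr u v w : S u -> S v -> S w -> a w (u + v) = a w u + a w v.
Proof. by move=> Su Sv Sw; rewrite (linear_onD (inner_linr Sw)). Qed.

Lemma innerBl u v w : S u -> S v -> S w -> a (u - v) w = a u w - a v w.
Proof. by move=> Su Sv Sw; rewrite (linear_onB (inner_lin ia Sw)). Qed.

Lemma innerBr u v w : S u -> S v -> S w -> a w (u - v) = a w u - a w v.
Proof. by move=> Su Sv Sw; rewrite (linear_onB (inner_linr Sw)). Qed.

Lemma innerZl c u w : S u -> S w -> a (c *: u) w = c * a u w.
Proof. by move=> Su Sw; rewrite (linear_onZ sS (inner_lin ia Sw)). Qed.

Lemma innerZr c u w : S u -> S w -> a w (c *: u) = c * a w u.
Proof. by move=> Su Sw; rewrite (linear_onZ sS (inner_linr Sw)). Qed.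

Lemma inner_sqrD u v : S u -> S v ->
  a (u + v) (u + v) = a u u + 2 * a u v + a v v.
Proof.
move=> Su Sv; rewrite innerDl ?innerDr//; last exact: subspaceD.
by rewrite (inner_sym ia Sv Su); ring.
Qed.

Lemma inner_sqrB u v : S u -> S v ->
  a (u - v) (u - v) = a u u - 2 * a u v + a v v.
Proof.
move=> Su Sv; rewrite innerBl ?innerBr//; last exact: subspaceB.
by rewrite (inner_sym ia Sv Su); ring.
Qed.

(** The quadratic t |-> a (u - t v) (u - t v) is nonnegative, at the minimizing
    t = a u v / a v v, or at a large multiple of 1 / a u v if v is isotropic. *)
Lemma inner_CS u v : S u -> S v -> a u v ^+ 2 <= a u u * a v v.
Proof.
move=> Su Sv.
have quad t : 0 <= a u u - 2 * t * a u v + t ^+ 2 * a v v.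
  have := inner_ge0 ia (subspaceB sS Su (subspaceZ sS t Sv)).
  rewrite inner_sqrB//; last exact: subspaceZ.
  by rewrite !(innerZl, innerZr)//; [lra|exact: subspaceZ].
have vv := inner_ge0 ia Sv; have uu := inner_ge0 ia Su.
have [v0|v0] := eqVneq (a v v) 0.
  rewrite v0 mulr0.
  have [->|uv0] := eqVneq (a u v) 0; first by rewrite expr0n.
  have := quad ((a u u + 1) / (2 * a u v)); rewrite v0.
  have -> : 2 * ((a u u + 1) / (2 * a u v)) * a u v = a u u + 1 by field.
  by lra.
have {}v0 : 0 < a v v by rewrite lt_neqAle eq_sym v0.
have := quad (a u v / a v v).
have -> : a u u - 2 * (a u v / a v v) * a u v + (a u v / a v v) ^+ 2 * a v v
  = (a u u * a v v - a u v ^+ 2) / a v v by field; rewrite gt_eqF.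
by rewrite ler_pdivlMr// mul0r subr_ge0.
Qed.

Lemma inner_CS_sqrt u v : S u -> S v ->
  `|a u v| <= Num.sqrt (a u u) * Num.sqrt (a v v).
Proof.
move=> Su Sv; rewrite -sqrtrM ?(inner_ge0 ia)// -sqrtr_sqr ler_wsqrtr//.
exact: inner_CS.
Qed.

End inner_theory.

(** The corrector problems are solved by this representation theorem.  The
    induction is on the number of spanning vectors, which may be dependent and
    need not lie in S.  If some s in S involves the last of them, subtracting
    from s the representative p of a s on the smaller subspace S' leaves a
    vector t orthogonal to S' with S = S' + <t>, and the representative of l on
    S' only has to be corrected along t. *)
Lemma riesz_finite (R : realType) (F : lmodType R) (a : F -> F -> R)
    (l : F -> R) (m : nat) (b : 'I_m -> F) (S : set F) :
  (forall u, S u -> exists c : 'I_m -> R, u = \sum_(i < m) c i *: b i) ->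
  inner_on S a -> (forall u, S u -> a u u = 0 -> u = 0) -> linear_on S l ->
  exists2 q, S q & forall w, S w -> a q w = l w.
Proof.
elim: m b S l => [|m IH] b S l spanS ia def ll.
  have sS := inner_sub ia; exists 0; first exact: sS.1.
  move=> w Sw; have [c ->] := spanS _ Sw; rewrite big_ord0.
  by rewrite (linear_on0 sS (inner_lin ia sS.1)) (linear_on0 sS ll).
have sS := inner_sub ia.
pose S' := [set u | S u /\ exists c : 'I_m -> R,
  u = \sum_(i < m) c i *: b (widen_ord (leqnSn m) i)].
have S'S : S' `<=` S by move=> u [].
have sS' : lin_subspace S'.
  split; first split; first exact: sS.1.
    by exists (fun=> 0); rewrite big1// => i _; rewrite scale0r.
  move=> c u v [Su [cu uE]] [Sv [cv vE]]; split; first exact: sS.2.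
  exists (fun i => c * cu i + cv i); rewrite uE vE scaler_sumr -big_split/=.
  by apply: eq_bigr => i _; rewrite scalerDl scalerA.
have ia' := sub_inner sS' S'S ia.
have def' u : S' u -> a u u = 0 -> u = 0 by move=> /S'S; exact: def.
have span' u : S' u -> exists c : 'I_m -> R,
    u = \sum_(i < m) c i *: b (widen_ord (leqnSn m) i) by case.
have riesz' l' : linear_on S' l' ->
    exists2 q, S' q & forall w, S' w -> a q w = l' w.
  by exact: (IH _ S' l' span' ia' def').
have [[s [Ss [c [sE c0]]]]|noS] := pselect (exists s, S s /\
    exists c : 'I_m.+1 -> R, s = \sum_(i < m.+1) c i *: b i /\ c ord_max != 0);
    last first.
  have SS' u : S u -> S' u.
    move=> Su; split => //; have [c uE] := spanS _ Su.
    exists (fun i => c (widen_ord (leqnSn m) i)).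
    rewrite uE big_ord_recr/=.
    have [->|c0] := eqVneq (c ord_max) 0; first by rewrite scale0r addr0.
    by case: noS; exists u; split => //; exists c.
  have [|q S'q qP] := riesz' l.
    by move=> ? ? ? /S'S ? /S'S ?; apply: ll.
  by exists q; [exact: S'S|move=> w /SS'; exact: qP].
have [|p S'p pP] := riesz' (a s).
  by move=> d u v /S'S Su /S'S Sv; rewrite (inner_linr ia Ss).
have [|q S'q qP] := riesz' l.
  by move=> ? ? ? /S'S ? /S'S ?; apply: ll.
pose t := s - p.
have Sp := S'S _ S'p; have Sq := S'S _ S'q.
have St : S t by exact: subspaceB.
have tS' w : S' w -> a t w = 0.
  by move=> S'w; have Sw := S'S _ S'w; rewrite (innerBl ia)// pP// subrr.
pose k := (l t - a q t) / a t t.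
exists (q + k *: t).
  by apply: subspaceD => //; exact: subspaceZ.
move=> w Sw; have [cw wE] := spanS _ Sw.
pose r := cw ord_max / c ord_max.
have S'w' : S' (w - r *: s).
  split; first by apply: subspaceB => //; exact: subspaceZ.
  exists (fun i => cw (widen_ord (leqnSn m) i) - r * c (widen_ord (leqnSn m) i)).
  rewrite wE sE !big_ord_recr/= scalerDr scalerA.
  rewrite (_ : r * c ord_max = cw ord_max); last by rewrite /r mulfVK.
  rewrite opprD addrACA subrr addr0 scaler_sumr -sumrB; apply: eq_bigr => i _.
  by rewrite scalerBl scalerA.
have {S'w'} [w' S'w' {}wE] : exists2 w', S' w' & w = r *: t + w'.
  exists (w - r *: s + r *: p).
    by apply: subspaceD => //; exact: subspaceZ.
  by rewrite /t scalerBr addrC -addrA [_ *: p + _]addrC subrK subrK.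
have Sw' := S'S _ S'w'.
have Skt : S (k *: t) by exact: subspaceZ.
have Srt : S (r *: t) by exact: subspaceZ.
rewrite wE ll// (innerDl ia)//; last exact: subspaceD.
rewrite !(innerDr ia)// !(innerZl ia)// !(innerZr ia)// (qP w')// (tS' w')//.
(* If t = 0, both sides vanish, whatever the value of k. *)
have kt : k * a t t = l t - a q t.
  have [t0|t0] := eqVneq (a t t) 0; last by rewrite /k mulfVK.
  have -> := def _ St t0.
  rewrite (linear_on0 sS (inner_linr ia sS.1)) mulr0 (linear_on0 sS ll).
  by rewrite (linear_on0 sS (inner_linr ia Sq)) subrr.
transitivity (r * (k * a t t + a q t) + l w'); first by ring.
by rewrite kt subrK.
Qed.

(** * The abstract two-scale estimate *)

Lemma sum_CS (R : realType) n (x y : 'I_n -> R) :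
  \sum_(i < n) x i * y i <=
  Num.sqrt (\sum_(i < n) x i ^+ 2) * Num.sqrt (\sum_(i < n) y i ^+ 2).
Proof.
pose a (u v : 'I_n -> R) := \sum_(i < n) u i * v i.
have ia : inner_on setT a.
  split => // [u _ c v w _ _|u v _ _|u _].
  - rewrite /a mulr_sumr -big_split/=; apply: eq_bigr => i _.
    by rewrite mulrDl mulrA.
  - by apply: eq_bigr => i _; rewrite mulrC.
  - by apply: sumr_ge0 => i _; rewrite -expr2 sqr_ge0.
exact: le_trans (ler_norm _) (inner_CS_sqrt ia (u:=x) (v:=y) I I).
Qed.

Lemma CS2 (R : realType) (x1 x2 y1 y2 : R) :
  x1 * y1 + x2 * y2 <=
  Num.sqrt (x1 ^+ 2 + x2 ^+ 2) * Num.sqrt (y1 ^+ 2 + y2 ^+ 2).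
Proof.
rewrite -sqrtrM ?addr_ge0 ?sqr_ge0//.
apply: le_trans (ler_norm _) _; rewrite -sqrtr_sqr ler_wsqrtr//.
by have := sqr_ge0 (x1 * y2 - x2 * y1); lra.
Qed.

(** Read q = a (w, v), Y = |w| |v|, G = |f| |v| and phi = a (f, v) for an inner
    product a, a vector w that makes an acute angle with v, and a
    perturbation f.  By the parallelogram identity and Cauchy-Schwarz for w - f, the second
    factor on the left bounds |w + f|^2 |v|^2, so that the inequality reads
    c |w + f| |v| <= sqrt 2 (|a (w + f, v)| + |f| |v|) with c the cosine of the
    angle between w and v.  The triangle inequality |w + f| <= |w| + |f| would
    only give |a (w + f, v)| + 2 |f| |v| on the right, which is too much for the
    constant sqrt 5. *)
Lemma two_scale_key (R : realType) (q Y G phi : R) :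
  0 <= q -> q <= Y -> `|phi| <= G ->
  q ^+ 2 * (2 * Y ^+ 2 + 2 * G ^+ 2 - (q - phi) ^+ 2)
    <= 2 * Y ^+ 2 * (`|q + phi| + G) ^+ 2.
Proof.
move=> q0 qY; rewrite ler_norml => /andP[Gphi phiG].
have [p0|p0] := ler0P (q + phi).
  (* Here q <= - phi <= G, and q^2 (Y^2 + G^2) <= Y^2 G^2 + q^4 by h1. *)
  have qG : q <= G by lra.
  have h1 : 0 <= (G ^+ 2 - q ^+ 2) * (Y ^+ 2 - q ^+ 2).
    by apply: mulr_ge0; rewrite subr_ge0 ler_sqr// nnegrE; lra.
  have h2 : 0 <= q ^+ 2 * ((q - phi) ^+ 2 - (2 * q) ^+ 2).
    by rewrite mulr_ge0 ?sqr_ge0// subr_ge0 ler_sqr// ?nnegrE; lra.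
  have h3 : 0 <= Y ^+ 2 * ((- (q + phi) + G) ^+ 2 - G ^+ 2).
    by rewrite mulr_ge0 ?sqr_ge0// subr_ge0 ler_sqr// ?nnegrE; lra.
  have h4 : 0 <= q ^+ 2 * q ^+ 2 by rewrite mulr_ge0// sqr_ge0.
  lra.
(* The coefficient of Y^2 in the right-hand side minus the left-hand one is
   nonnegative, so that Y = q is the worst case. *)
have h1 : 0 <= (Y ^+ 2 - q ^+ 2) * ((q + phi + G) ^+ 2 - q ^+ 2).
  by apply: mulr_ge0; rewrite subr_ge0 ler_sqr// ?nnegrE; lra.
have h2 : 0 <= q ^+ 2 * (q + phi) ^+ 2 by rewrite mulr_ge0// sqr_ge0.
have h3 : 0 <= q ^+ 2 * phi ^+ 2 by rewrite mulr_ge0// sqr_ge0.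
have h4 : 0 <= q ^+ 2 * (G * (q + phi)).
  by rewrite mulr_ge0 ?sqr_ge0// mulr_ge0//; lra.
lra.
Qed.

Section two_scale.
Context (R : realType) (F : lmodType R) (N : nat).
Context (V VH : set F) (Vf : 'I_N -> set F) (a b : F -> F -> R).
Context (aT : 'I_N -> F -> F -> R) (Q : 'I_N -> F -> F) (alpha beta C : R).
Hypotheses (ia : inner_on V a) (ib : inner_on V b).
Hypotheses (alpha0 : 0 < alpha) (alpha_beta : alpha <= beta) (C1 : 1 <= C).
Hypothesis a_ge : forall u, V u -> alpha * b u u <= a u u.
Hypothesis a_le : forall u, V u -> a u u <= beta * b u u.
Hypothesis b_def : forall u, V u -> b u u = 0 -> u = 0.
Hypotheses (sVH : lin_subspace VH) (VHV : VH `<=` V).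
Hypotheses (sVf : forall i, lin_subspace (Vf i)) (VfV : forall i, Vf i `<=` V).
Hypothesis VH_Vf : forall uH uf, VH uH -> (forall i, Vf i (uf i)) ->
  uH = \sum_(i < N) uf i -> uH = 0.
Hypothesis overlap : forall uf, (forall i, Vf i (uf i)) ->
  a (\sum_(i < N) uf i) (\sum_(i < N) uf i) <= C * \sum_(i < N) a (uf i) (uf i).
Hypothesis VfQ : forall i u, VH u -> Vf i (Q i u).
Hypothesis aQ : forall i u w, VH u -> Vf i w -> a (Q i u) w = aT i u w.
Hypothesis Q0 : forall i, Q i 0 = 0.

Let rho := C * (beta / alpha).
Let sV := inner_sub ia.

Implicit Types u v : F * ('I_N -> F).

Let VV u := VH u.1 /\ forall i, Vf i (u.2 i).
Let z u := u.1 - \sum_(i < N) u.2 i.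
Let e u i := Q i u.1 - u.2 i.
Let E2 u := rho * \sum_(i < N) a (e u i) (e u i).

(** The two-scale form and norms over an abstract space: b stands for the inner
    product of the gradients, Q i for the corrector of the element i. *)
Definition tsform u v : R := a (z u) v.1 +
  Num.sqrt rho * \sum_(i < N) (a (u.2 i) (v.2 i) - aT i u.1 (v.2 i)).
Definition tsnorm1 v : R :=
  Num.sqrt (b v.1 v.1 + \sum_(i < N) b (v.2 i) (v.2 i)).
Definition tsnorma u : R := Num.sqrt (a (z u) (z u) + E2 u).

Let beta0 : 0 < beta. Proof. exact: lt_le_trans alpha_beta. Qed.

Let rho0 : 0 < rho.
Proof. by rewrite mulr_gt0 ?divr_gt0 ?(lt_le_trans ltr01 C1). Qed.

Let Ve u i : VV u -> Vf i (e u i).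
Proof. by move=> [u1 u2]; exact: (subspaceB (sVf i) (VfQ i u1) (u2 i)). Qed.

Let Vz u : VV u -> V (z u).
Proof.
move=> [u1 u2]; apply: (subspaceB sV); first exact: VHV.
by apply: (subspace_sum sV) => i; exact: VfV.
Qed.

Let sum_e_ge0 u : VV u -> 0 <= \sum_(i < N) a (e u i) (e u i).
Proof.
by move=> VVu; apply: sumr_ge0 => i _; apply: (inner_ge0 ia); apply/VfV/Ve.
Qed.

Let E2_ge0 u : VV u -> 0 <= E2 u.
Proof. by move=> ?; rewrite /E2 mulr_ge0 ?sum_e_ge0// ltW. Qed.

(** The corrector equation turns the fine part of the form into minus the energy
    product of the defects e = Q u_H - u_T with the fine test functions. *)
Lemma tsformE u v : VV u -> VV v ->
  tsform u v = a (z u) v.1 - Num.sqrt rho * \sum_(i < N) a (e u i) (v.2 i).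
Proof.
move=> VVu VVv; congr (_ + _); rewrite -mulrN -sumrN; congr (_ * _).
have [u1 u2] := VVu; have [v1 v2] := VVv.
apply: eq_bigr => i _; rewrite (innerBl ia).
- by rewrite aQ// opprB.
- exact/VfV/VfQ.
- exact/VfV/u2.
- exact/VfV/v2.
Qed.

Let a_le_sqrt (x y : F) : V x -> V y ->
  `|a x y| <= Num.sqrt (a x x) * (Num.sqrt beta * Num.sqrt (b y y)).
Proof.
move=> Vu Vv; apply: le_trans (inner_CS_sqrt ia Vu Vv) _.
rewrite ler_wpM2l ?sqrtr_ge0// -sqrtrM ?(ltW beta0)// ler_wsqrtr//.
exact: a_le.
Qed.

(** Cauchy-Schwarz for each product, then for the sum over the elements, then for
    the coarse and fine parts. *)
Lemma tsform_continuous u v : VV u -> VV v ->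
  tsform u v <= Num.sqrt beta * (tsnorma u * tsnorm1 v).
Proof.
move=> VVu VVv; rewrite tsformE//; have [v1 v2] := VVv.
pose xs := fun i => Num.sqrt (a (e u i) (e u i)).
pose ys := fun i => Num.sqrt (b (v.2 i) (v.2 i)).
have h1 : a (z u) v.1 <=
    Num.sqrt beta * (Num.sqrt (a (z u) (z u)) * Num.sqrt (b v.1 v.1)).
  rewrite mulrCA; apply: le_trans (ler_norm _) _; apply: a_le_sqrt.
    exact: Vz.
  exact: VHV.
have h2 : - \sum_(i < N) a (e u i) (v.2 i) <=
    Num.sqrt beta * \sum_(i < N) xs i * ys i.
  rewrite -sumrN mulr_sumr; apply: ler_sum => i _; rewrite mulrCA.
  apply: le_trans (ler_norm _) _; rewrite normrN; apply: a_le_sqrt.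
    exact/VfV/Ve.
  exact/VfV/v2.
have h3 := sum_CS xs ys.
have xsE : \sum_(i < N) xs i ^+ 2 = \sum_(i < N) a (e u i) (e u i).
  by apply: eq_bigr => i _; rewrite sqr_sqrtr// (inner_ge0 ia)//; exact/VfV/Ve.
have ysE : \sum_(i < N) ys i ^+ 2 = \sum_(i < N) b (v.2 i) (v.2 i).
  by apply: eq_bigr => i _; rewrite sqr_sqrtr// (inner_ge0 ib)//; exact/VfV/v2.
have b_ge0 : 0 <= \sum_(i < N) b (v.2 i) (v.2 i).
  by rewrite -ysE sumr_ge0// => i _; exact: sqr_ge0.
have := CS2 (Num.sqrt (a (z u) (z u))) (Num.sqrt (E2 u))
            (Num.sqrt (b v.1 v.1)) (Num.sqrt (\sum_(i < N) b (v.2 i) (v.2 i))).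
rewrite !sqr_sqrtr ?E2_ge0 ?(inner_ge0 ia (Vz VVu)) ?(inner_ge0 ib (VHV v1))//.
rewrite -/(tsnorma u) -/(tsnorm1 v) => h4.
apply: le_trans (ler_wpM2l (sqrtr_ge0 beta) h4); rewrite mulrDr.
rewrite lerD// -mulrN; apply: le_trans (ler_wpM2l (sqrtr_ge0 rho) h2) _.
rewrite mulrCA ler_wpM2l ?sqrtr_ge0// /E2 (sqrtrM _ (ltW rho0)) -mulrA.
by rewrite ler_wpM2l ?sqrtr_ge0// -xsE -ysE.
Qed.

Let a_def (u : F) : V u -> a u u = 0 -> u = 0.
Proof.
move=> Vu u0; apply: b_def => //; apply/eqP; rewrite eq_le (inner_ge0 ib)// andbT.
by rewrite -(pmulr_rle0 _ alpha0) -u0; exact: a_ge.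
Qed.

(** A zero norm makes the coarse part a sum of fine functions, hence zero; then
    the correctors vanish, and so do the fine parts. *)
Lemma tsnorma_gt0 u : VV u -> u <> (0, 0) -> 0 < tsnorma u.
Proof.
move=> VVu u0; rewrite sqrtr_gt0 lt_neqAle addr_ge0 ?E2_ge0//; last first.
  exact/(inner_ge0 ia)/Vz.
rewrite andbT eq_sym paddr_eq0 ?E2_ge0//; last exact/(inner_ge0 ia)/Vz.
apply/negP => /andP[/eqP z0]; rewrite /E2 mulf_eq0 gt_eqF//= => /eqP e0.
have [u1 u2] := VVu; apply: u0.
have u10 : u.1 = 0.
  apply: (VH_Vf u1 u2); apply/eqP; rewrite -subr_eq0; apply/eqP.
  exact/a_def/z0/Vz.
have ei0 i : e u i = 0.
  apply: a_def; first exact/VfV/Ve.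
  move/psumr_eq0P : e0; apply => // j _.
  exact/(inner_ge0 ia)/VfV/Ve.
rewrite [u]surjective_pairing u10; congr pair; apply/funext => i.
by have := ei0 i; rewrite /e u10 Q0 sub0r => /eqP; rewrite oppr_eq0 => /eqP.
Qed.

Context (g : R).
Hypotheses (g0 : 0 < g) (g_le : g <= Num.sqrt alpha).
Let w uH := uH - \sum_(i < N) Q i uH.
Hypothesis g_infsup : forall uH, VH uH -> uH <> 0 -> exists2 v, VH v &
  [/\ 0 < a (w uH) (w uH), 0 < b v v & 24 / 25 * g *
    (Num.sqrt (a (w uH) (w uH)) * Num.sqrt (b v v)) <= a (w uH) v].

Let g2_le : g ^+ 2 <= alpha.
Proof.
rewrite -[leRHS]sqr_sqrtr; last exact: ltW.
by rewrite ler_sqr// nnegrE ?sqrtr_ge0// ltW.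
Qed.

Let overlap_e u : VV u ->
  beta * a (\sum_(i < N) e u i) (\sum_(i < N) e u i) <= alpha * E2 u.
Proof.
move=> VVu; have := overlap (fun i => Ve i VVu).
rewrite -(ler_pM2l beta0) => /le_trans; apply; rewrite /E2 /rho le_eqVlt.
by apply/orP; left; apply/eqP; field; rewrite gt_eqF.
Qed.

(** The coarse component of the test function.  For u_H <> 0, it is the
    multiple P / |v|_1 of a function v that nearly realizes the inf-sup constant
    at w = u_H - Q u_H; with z = w + f, f being the sum of the defects, the
    coefficient P = a (z, v) / (sqrt alpha |v|_1) may have either sign.  The
    last bound follows from the key inequality, because the overlap bound and
    the value of rho give |f| |v| <= sqrt (alpha E2) |v|_1.  The factor 24/25,
    whose square exceeds 9/10, replaces the limit along a maximizing sequence of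
    test functions: the final estimate has room for it. *)
Lemma coarse_test u : VV u -> exists2 v, VH v & exists P : R,
  [/\ a (z u) v = Num.sqrt alpha * P ^+ 2, b v v <= P ^+ 2 &
      9 / 10 * (g ^+ 2 * a (z u) (z u))
        <= 2 * (alpha * (`|P| + Num.sqrt (E2 u)) ^+ 2)].
Proof.
move=> VVu; have [u1 u2] := VVu; have E0 := E2_ge0 VVu.
set f := \sum_(i < N) e u i.
have Vf' : V f by apply: (subspace_sum sV) => i; exact/VfV/Ve.
have zE : z u = w u.1 + f by rewrite /z /w /f /e sumrB addrA subrK.
have ff := overlap_e VVu; rewrite -/f in ff.
have ff0 : 0 <= a f f by exact: inner_ge0 ia _ Vf'.
have VQ : V (\sum_(i < N) Q i u.1).
  by apply: (subspace_sum sV) => i; exact/VfV/VfQ.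
have [u10|u10] := pselect (u.1 = 0).
  exists 0; first exact: sVH.1.
  exists 0; rewrite expr0n/= mulr0 (linear_on0 sV (inner_lin ib sV.1)) normr0 add0r.
  rewrite (linear_on0 sV (inner_linr ia (Vz VVu))); split=> //.
  have -> : z u = f.
    by rewrite zE /w u10 big1 ?subrr ?add0r// => i _; rewrite Q0.
  rewrite sqr_sqrtr//.
  have h1 : g ^+ 2 * a f f <= alpha * a f f by rewrite ler_wpM2r.
  have h2 : alpha * a f f <= beta * a f f by rewrite ler_wpM2r.
  have h3 : 0 <= g ^+ 2 * a f f by rewrite mulr_ge0// sqr_ge0.
  lra.
have [v Hv [ww0 vv0 hq]] := g_infsup u1 u10.
have Vv := VHV Hv.
have Vw : V (w u.1) by apply: (subspaceB sV) => //; exact: VHV.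
set W := a (w u.1) (w u.1) in ww0 hq *.
set T := b v v in vv0 hq *.
set q := a (w u.1) v in hq *.
set phi := a f v.
set B := a v v.
have B0 : 0 < B by apply: lt_le_trans (a_ge Vv); rewrite mulr_gt0.
have q0 : 0 <= q by apply: le_trans hq; rewrite !mulr_ge0 ?sqrtr_ge0// ltW.
have zv : a (z u) v = q + phi by rewrite zE (innerDl ia).
have Y2 : Num.sqrt (W * B) ^+ 2 = W * B by rewrite sqr_sqrtr// mulr_ge0// ltW.
have G2 : Num.sqrt (a f f * B) ^+ 2 = a f f * B.
  by rewrite sqr_sqrtr// mulr_ge0// ltW.
have qY : q <= Num.sqrt (W * B).
  rewrite sqrtrM ?(ltW ww0)//; apply: le_trans (ler_norm _) _.
  exact: (inner_CS_sqrt ia).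
have phiG : `|phi| <= Num.sqrt (a f f * B).
  by rewrite sqrtrM//; exact: (inner_CS_sqrt ia).
have := two_scale_key q0 qY phiG; rewrite Y2 G2 => key.
have zz : B * a (z u) (z u) <= 2 * (W * B) + 2 * (a f f * B) - (q - phi) ^+ 2.
  have := inner_CS ia (subspaceB sV Vw Vf') Vv.
  rewrite (innerBl ia)// (inner_sqrB ia)// zE (inner_sqrD ia)//.
  rewrite -/q -/phi -/B -/W; lra.
have {key zz} key : q ^+ 2 * a (z u) (z u)
    <= 2 * W * (`|q + phi| + Num.sqrt (a f f * B)) ^+ 2.
  rewrite -(ler_pM2l B0) mulrCA.
  apply: le_trans (ler_wpM2l (sqr_ge0 q) zz) (le_trans key _).
  by rewrite le_eqVlt; apply/orP; left; apply/eqP; ring.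
have zz0 : 0 <= a (z u) (z u) by exact/(inner_ge0 ia)/Vz.
have {}hq : 9 / 10 * g ^+ 2 * (W * T) <= q ^+ 2.
  have : (24 / 25 * g * (Num.sqrt W * Num.sqrt T)) ^+ 2 <= q ^+ 2.
    by rewrite ler_sqr// ?nnegrE// !mulr_ge0 ?sqrtr_ge0// ltW.
  rewrite !exprMn !sqr_sqrtr ?(ltW ww0) ?(ltW vv0)//.
  have : 0 <= g ^+ 2 * (W * T) by rewrite mulr_ge0 ?sqr_ge0// mulr_ge0// ltW.
  lra.
have {hq} key : 9 / 10 * (g ^+ 2 * a (z u) (z u)) * T
    <= 2 * (`|q + phi| + Num.sqrt (a f f * B)) ^+ 2.
  rewrite -(ler_pM2l ww0); have := ler_wpM2r zz0 hq; lra.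
have GE : Num.sqrt (a f f * B) <= Num.sqrt (alpha * T) * Num.sqrt (E2 u).
  rewrite -sqrtrM ?mulr_ge0 ?(ltW alpha0) ?(ltW vv0)// ler_wsqrtr//.
  have := ler_wpM2l ff0 (a_le Vv); have := ler_wpM2r (ltW vv0) ff.
  rewrite -/B -/T; lra.
have s0 : 0 < Num.sqrt (alpha * T) by rewrite sqrtr_gt0 mulr_gt0.
pose P := (q + phi) / Num.sqrt (alpha * T).
have PE : q + phi = Num.sqrt (alpha * T) * P by rewrite mulrC mulfVK// gt_eqF.
have t0 : 0 < Num.sqrt T by rewrite sqrtr_gt0.
exists ((P / Num.sqrt T) *: v); first exact: (subspaceZ sVH).
exists P; split.
- rewrite (innerZr ia)//; last exact: Vz.
  rewrite zv PE sqrtrM ?(ltW vv0, ltW alpha0)//; field.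
  by rewrite gt_eqF.
- have Vv' : V ((P / Num.sqrt T) *: v) by exact: (subspaceZ sV).
  rewrite (innerZl ib)// (innerZr ib)// mulrA -expr2 exprMn exprVn.
  rewrite sqr_sqrtr ?(ltW vv0)//.
  by rewrite -/T mulfVK// gt_eqF.
- rewrite -(ler_pM2r vv0); apply: le_trans key _.
  have -> : 2 * (alpha * (`|P| + Num.sqrt (E2 u)) ^+ 2) * T =
      2 * ((Num.sqrt (alpha * T) * (`|P| + Num.sqrt (E2 u))) ^+ 2).
    by rewrite exprMn sqr_sqrtr ?mulr_ge0 ?(ltW vv0, ltW alpha0)//; ring.
  rewrite ler_wpM2l// ler_sqr ?nnegrE.
  + rewrite mulrDr lerD// PE normrM ger0_norm//; exact: ltW.
  + by rewrite addr_ge0// sqrtr_ge0.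
  + by rewrite mulr_ge0 ?addr_ge0 ?sqrtr_ge0.
Qed.

(** With fine components - sqrt (alpha rho) e, the form takes the value
    sqrt alpha (P^2 + E2) and the test norm is at most sqrt (P^2 + E2), where
    E2 = rho (sum of |e|^2).  It remains to compare P^2 + E2 with the squared
    trial norm |z|^2 + E2 by means of the bound on |z|. *)
Lemma tsform_infsup u : VV u -> u <> (0, 0) -> exists v,
  [/\ VV v, v <> (0, 0), 0 < tsnorm1 v &
      g / Num.sqrt 5 * (tsnorma u * tsnorm1 v) <= tsform u v].
Proof.
move=> VVu u0; have [u1 u2] := VVu.
have [vH Hv [P [azv bvv gP]]] := coarse_test VVu.
have E0 := E2_ge0 VVu.
pose s := Num.sqrt (alpha * rho).
pose v : F * ('I_N -> F) := (vH, fun i => (- s) *: e u i).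
have VVv : VV v.
  by split => // i; apply: (subspaceZ (sVf i)); exact: Ve.
have s2 : s ^+ 2 = alpha * rho by rewrite sqr_sqrtr// mulr_ge0// ltW.
have formE : tsform u v = Num.sqrt alpha * (P ^+ 2 + E2 u).
  rewrite tsformE//= azv mulrDr; congr (_ + _).
  have -> : \sum_(i < N) a (e u i) ((- s) *: e u i) =
      - s * \sum_(i < N) a (e u i) (e u i).
    rewrite mulr_sumr; apply: eq_bigr => i _.
    by rewrite (innerZr ia)//; exact/VfV/Ve.
  rewrite /s (sqrtrM _ (ltW alpha0)) /E2 -[in RHS](sqr_sqrtr (ltW rho0)); ring.
have normE : tsnorm1 v <= Num.sqrt (P ^+ 2 + E2 u).
  rewrite ler_wsqrtr//= lerD// /E2.
  rewrite mulr_sumr; apply: ler_sum => i _.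
  have Vei : V (e u i) by exact/VfV/Ve.
  have Vsei : V ((- s) *: e u i) by exact: (subspaceZ sV).
  rewrite (innerZl ib)// (innerZr ib)// mulrA mulrNN -expr2 s2 mulrAC mulrC.
  by rewrite ler_wpM2l ?(ltW rho0)//; exact: a_ge.
have zz0 : 0 <= a (z u) (z u) by exact/(inner_ge0 ia)/Vz.
have main : g ^+ 2 * (a (z u) (z u) + E2 u) <= 5 * (alpha * (P ^+ 2 + E2 u)).
  have h1 := ler_wpM2r E0 g2_le.
  pose X := `|P|; pose S := Num.sqrt (E2 u).
  have SE : E2 u = S ^+ 2 by rewrite sqr_sqrtr.
  have XE : P ^+ 2 = X ^+ 2 by rewrite real_normK// num_real.
  rewrite -/X -/S in gP; rewrite SE in h1 *; rewrite XE.
  (* 5 (X^2 + S^2) - S^2 - 20/9 (X + S)^2 = (5 X - 4 S)^2 / 9 *)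
  have : 0 <= alpha * (5 * X - 4 * S) ^+ 2 by rewrite mulr_ge0 ?sqr_ge0// ltW.
  lra.
have na0 := tsnorma_gt0 VVu u0.
have PE0 : 0 < P ^+ 2 + E2 u.
  have : 0 < 5 * (alpha * (P ^+ 2 + E2 u)).
    apply: lt_le_trans main; rewrite mulr_gt0 ?exprn_gt0//.
    by move: na0; rewrite /tsnorma sqrtr_gt0.
  by rewrite pmulr_rgt0// pmulr_rgt0.
have form0 : 0 < tsform u v by rewrite formE mulr_gt0// sqrtr_gt0.
have n10 : 0 < tsnorm1 v.
  have := lt_le_trans form0 (tsform_continuous VVu VVv).
  have sb0 : 0 < Num.sqrt beta by rewrite sqrtr_gt0.
  by rewrite (pmulr_rgt0 _ sb0) (pmulr_rgt0 _ na0).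
exists v; split => //.
  move=> v0; move: n10; rewrite v0 /tsnorm1/= big1 ?addr0.
    by rewrite (linear_on0 sV (inner_lin ib sV.1)) sqrtr0 ltxx.
  by move=> i _; exact: (linear_on0 sV (inner_lin ib sV.1)).
have na : g * tsnorma u <= Num.sqrt 5 * (Num.sqrt alpha * Num.sqrt (P ^+ 2 + E2 u)).
  rewrite -[g]ger0_norm ?(ltW g0)// -sqrtr_sqr -!sqrtrM ?sqr_ge0 ?(ltW alpha0)//.
  by rewrite ler_wsqrtr.
rewrite formE mulrA -[P ^+ 2 + E2 u in leRHS]sqr_sqrtr ?(ltW PE0)// expr2 mulrA.
apply: ler_pM => //; rewrite ?sqrtr_ge0//.
  by rewrite mulr_ge0 ?sqrtr_ge0// divr_ge0 ?sqrtr_ge0// ltW.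
by rewrite mulrAC ler_pdivrMr ?sqrtr_gt0// mulrC [leRHS]mulrC mulrC.
Qed.

End two_scale.

(** * Square roots of positive semidefinite matrices *)

Section euclidean_theory.
Context (R : realType) (n : nat).
Implicit Types (x y z : 'rV[R]_n) (B C : 'M[R]_n).

Lemma dotvE x y : dotv x y = \sum_(i < n) x 0 i * y 0 i.
Proof. by rewrite /dotv mxE; apply: eq_bigr => i _; rewrite mxE. Qed.

Lemma dotvC x y : dotv x y = dotv y x.
Proof. by rewrite !dotvE; apply: eq_bigr => i _; rewrite mulrC. Qed.

Lemma dotvv_ge0 x : 0 <= dotv x x.
Proof. by rewrite dotvE sumr_ge0// => i _; rewrite -expr2 sqr_ge0. Qed.

Lemma dotvv_eq0 x : dotv x x = 0 -> x = 0.
Proof.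
rewrite dotvE => /psumr_eq0P x0; apply/rowP => i; rewrite mxE.
have /eqP := x0 (fun i _ => sqr_ge0 (x 0 i)) i isT.
by rewrite mulf_eq0 orbb => /eqP.
Qed.

Lemma enorm_sqr x : enorm x ^+ 2 = dotv x x.
Proof. by rewrite sqr_sqrtr// dotvv_ge0. Qed.

Lemma dotvDl x y z : dotv (x + y) z = dotv x z + dotv y z.
Proof. by rewrite /dotv mulmxDl mxE. Qed.

Lemma dotvZl c x y : dotv (c *: x) y = c * dotv x y.
Proof. by rewrite /dotv -scalemxAl mxE. Qed.

Lemma dotv_appmx B x y : B^T = B -> dotv (appmx B x) y = dotv x (appmx B y).
Proof. by move=> BT; rewrite /dotv /appmx trmx_mul trmxK BT mulmxA. Qed.

End euclidean_theory.

Lemma poly_interpolation (K : fieldType) (g : K -> K) (s : seq K) :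
  exists p : {poly K}, forall x, x \in s -> p.[x] = g x.
Proof.
elim: s => [|x s [p pP]]; first by exists 0.
have [xs|xs] := boolP (x \in s).
  by exists p => y; rewrite inE => /predU1P[->|]; exact: pP.
pose r := \prod_(y <- s) ('X - y%:P).
have rx : r.[x] != 0 by rewrite -/(root _ _) root_prod_XsubC.
exists (p + ((g x - p.[x]) / r.[x]) *: r) => y; rewrite inE hornerD hornerZ.
case/predU1P => [->|ys]; first by rewrite mulfVK// addrC subrK.
have /eqP -> : root r y by rewrite root_prod_XsubC.
by rewrite mulr0 addr0 pP.
Qed.

Lemma horner_mx_diagonalizable (K : fieldType) (n : nat) (P : 'M[K]_n.+1)
    (D : 'rV[K]_n.+1) (q : {poly K}) :
  P \in unitmx -> (forall i, q.[D 0 i] = D 0 i) ->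
  horner_mx (invmx P *m diag_mx D *m P) q = invmx P *m diag_mx D *m P.
Proof.
move=> Pu qD; rewrite horner_mx_uconjC// horner_mx_diag.
by congr (_ *m diag_mx _ *m _); apply/rowP => i; rewrite mxE qD.
Qed.

(** The square root is a polynomial in B.  Over the complex numbers B is
    diagonalizable with eigenvalues that are real, and nonnegative because B
    has a real eigenvector for each of them.  Let p interpolate the fourth root
    on the spectrum; then Q = p(B) is symmetric and Q^4 = B, so that C = Q^2 is
    a square root and is positive semidefinite as the square of a symmetric
    matrix. *)
Lemma psd_sqrt_exists (R : rcfType) (n : nat) (B : 'M[R]_n.+1) :
  B^T = B -> (forall x : 'rV_n.+1, 0 <= (x *m B *m x^T) 0 0) ->
  exists C : 'M[R]_n.+1, [/\ C^T = C,
    forall x : 'rV_n.+1, 0 <= (x *m C *m x^T) 0 0 & C *m C = B].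
Proof.
move=> BT Bge0; pose f := real_complex R; pose A := map_mx f B.
have realA : A \is a mxOver Num.real.
  by apply/mxOverP => i j; rewrite mxE; apply/complex_realP; exists (B i j).
have Aherm : A \is hermsymmx.
  apply: realsym_hermsym => //; apply/is_hermitianmxP.
  rewrite expr0 scale1r; apply/matrixP => i j.
  by rewrite !mxE -[in LHS]BT mxE.
have /orthomx_spectralP := hermitian_normalmx Aherm.
set P := spectralmx A; set D := spectral_diag A => AE.
have Pu : P \in unitmx by exact: spectral_unit.
have /mxOverP Dreal := hermitian_spectral_diag_real Aherm.
have [l lE] : exists l : 'I_n.+1 -> R, forall i, D 0 i = f (l i).
  apply: (@fin_all_exists _ _ (fun i t => D 0 i = f t)) => i.
  exact/complex_realP/Dreal.
have l0 i : 0 <= l i.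
  have : eigenvalue A (f (l i)).
    apply/eigenvalueP; exists (row i P); last first.
      apply/eqP => ri; have := row_free_unit P; rewrite Pu => rfP.
      have /row_freeP[Z PZ] := rfP.
      have := congr1 (mulmx^~ Z) ri; rewrite -row_mul PZ mul0mx.
      by move/rowP/(_ i); rewrite !mxE eqxx => /eqP; rewrite oner_eq0.
    rewrite -row_mul [in LHS]AE mulmxA mulmxA mulmxV// mul1mx row_mul.
    by rewrite row_diag_mx -scalemxAl -rowE lE.
  rewrite eigenvalue_map => /eigenvalueP[v vB v0].
  have := Bge0 v; rewrite vB -scalemxAl mxE.
  have vv : 0 < (v *m v^T) 0 0.
    rewrite lt_neqAle; apply/andP; split; last first.
      by rewrite mxE sumr_ge0// => j _; rewrite mxE -expr2 sqr_ge0.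
    apply: contra v0 => /eqP/esym; rewrite mxE => vv; apply/eqP/rowP => j.
    have /psumr_eq0P : \sum_j v 0 j ^+ 2 = 0.
      by rewrite -[RHS]vv; apply: eq_bigr => k _; rewrite mxE.
    move=> /(_ (fun i _ => sqr_ge0 (v 0 i)) j isT)/eqP.
    by rewrite sqrf_eq0 mxE => /eqP.
  by rewrite pmulr_lge0.
have [p pP] := poly_interpolation (fun x => Num.sqrt (Num.sqrt x))
  [seq l i | i : 'I_n.+1].
have pl i : p.[l i] ^+ 4 = l i.
  rewrite pP ?map_f ?mem_enum// (exprM _ 2 2).
  by rewrite !sqr_sqrtr ?sqrtr_ge0.
pose Q := horner_mx B p.
have QT : Q^T = Q.
  suff : forall q, (horner_mx B q)^T = horner_mx B q by exact.
  elim/poly_ind => [|q c IH]; first by rewrite rmorph0 trmx0.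
  rewrite rmorphD rmorphM/= horner_mx_X horner_mx_C linearD/= tr_scalar_mx.
  rewrite trmx_mul IH BT; congr (_ + _).
  by apply/comm_mx_horner.
have QQ : (Q *m Q) *m (Q *m Q) = B.
  have -> : (Q *m Q) *m (Q *m Q) = horner_mx B (p ^+ 4).
    by rewrite rmorphXn/= -/Q (exprM _ 2 2) !expr2.
  suff: map_mx f (horner_mx B (p ^+ 4)) = map_mx f B.
    by move=> /matrixP h; apply/matrixP => i j; have := h i j; rewrite !mxE => -[].
  rewrite map_horner_mx -/A AE; apply: horner_mx_diagonalizable => // i.
  by rewrite lE horner_map horner_exp pl.
exists (Q *m Q); split => //; first by rewrite trmx_mul QT.
move=> x; have -> : x *m (Q *m Q) *m x^T = (x *m Q) *m (x *m Q)^T.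
  by rewrite trmx_mul QT !mulmxA.
by rewrite mxE sumr_ge0// => j _; rewrite [X in _ * X]mxE -expr2 sqr_ge0.
Qed.

Lemma sqrtmxP (R : realType) (n : nat) (B : 'M[R]_n.+1) :
  B^T = B -> (forall x, 0 <= dotv x (appmx B x)) ->
  [/\ (sqrtmx B)^T = sqrtmx B,
      forall x, 0 <= dotv (appmx (sqrtmx B) x) x
    & sqrtmx B *m sqrtmx B = B].
Proof.
move=> BT Bge0; apply: (xgetPex 0 (P := [set C | [/\ C^T = C,
  forall x, 0 <= dotv (appmx C x) x & C *m C = B]])).
have [x|C [CT C0 CC]] := @psd_sqrt_exists _ _ B BT.
  by have := Bge0 x; rewrite /dotv /appmx trmx_mul trmxK mulmxA.
by exists C; split => // x; rewrite /dotv /appmx CT.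
Qed.

(** The square root C is symmetric, so that |C x|^2 = C^2 x . x. *)
Lemma enorm_sqrtmx (R : realType) (n : nat) (B : 'M[R]_n.+1) x :
  B^T = B -> (forall x, 0 <= dotv x (appmx B x)) ->
  enorm (appmx (sqrtmx B) x) ^+ 2 = dotv (appmx B x) x.
Proof.
move=> BT B0; have [CT _ CC] := sqrtmxP BT B0; set C := sqrtmx B in CT CC *.
by rewrite enorm_sqr dotv_appmx// dotvC /appmx -mulmxA -trmx_mul CC.
Qed.

(** * Open sets and Lebesgue measure on row vectors *)

Section row_measure.
Context (R : realType) (n : nat).
Implicit Types (x y : 'rV[R]_n) (U : set 'rV[R]_n).

Definition cube n (x : 'rV[R]_n) (r : R) : set 'rV[R]_n :=
  [set y | forall i, `|x 0 i - y 0 i| < r].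

Lemma cube_ball x r : 0 < r -> cube x r = ball x r.
Proof.
move=> r0; apply/seteqP; split => y.
  by move=> xy; split => // i j; rewrite (ord1 i); exact: xy.
by move=> [_ xy] i; exact: xy.
Qed.

Lemma measurable_cube x r : measurable (cube x r).
Proof.
have -> : cube x r = \bigcap_(i in [set: 'I_n])
    ((fun y : 'rV[R]_n => y 0 i : measurableTypeR R) @^-1` ball (x 0 i) r).
  by apply/seteqP; split => y xy i => [_|]; exact: xy.
apply: fin_bigcap_measurable; first exact: finite_finset.
move=> i _; rewrite -[X in measurable X]setTI.
by apply: measurable_coord => //; rewrite ball_itv; exact: measurable_itv.
Qed.

(** An open set is the union of the countably many rational cubes that it
    contains. *)
Lemma open_measurable_row U : open U -> measurable U.
Proof.
move=> oU; pose C (p : 'rV[rat]_n * rat) : set 'rV[R]_n :=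
  cube (map_mx ratr p.1) (ratr p.2).
have -> : U = \bigcup_p (if `[< C p `<=` U >] then C p else set0).
  apply/seteqP; split => [x Ux|x [p _]]; last first.
    by case: ifPn => // /asboolP pU; exact: pU.
  have /nbhs_ballP[r /= r0 rU] : nbhs x U by exact: open_nbhs_nbhs.
  have [q /[!in_itv]/= /andP[q0 qr]] : exists q, (ratr q : R) \in `]0, (r / 2)[.
    by apply: rat_in_itvoo; rewrite divr_gt0.
  have [c cP] : exists c : 'I_n -> rat, forall i,
      (ratr (c i) : R) \in `]x 0 i, x 0 i + ratr q[.
    apply: (@fin_all_exists _ _
      (fun i t => (ratr t : R) \in `]x 0 i, x 0 i + ratr q[)) => i.
    by apply: rat_in_itvoo; rewrite ltrDl.
  have cU : C (\row_i c i, q) `<=` U.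
    move=> y cy; apply: rU; rewrite -cube_ball// => i.
    have := cP i; rewrite in_itv/= => /andP[].
    have := cy i; rewrite !mxE ltr_distl => /andP[] ? ? ? ?.
    by rewrite ltr_distl; lra.
  exists (\row_i c i, q) => //; rewrite asboolT// => i.
  have := cP i; rewrite in_itv/= !mxE => /andP[] ? ?.
  by rewrite ltr_distl; lra.
apply: countable_bigcupT_measurable; first exact: (@countableP _ [set: _]).
by move=> p; case: ifP => // _; exact: measurable_cube.
Qed.

Lemma closed_measurable_row U : closed U -> measurable U.
Proof.
move=> cU; rewrite -[U]setCK; apply: measurableC; apply: open_measurable_row.
exact: closed_openC.
Qed.

Lemma continuous_measurable_row (f : 'rV[R]_n -> R) :
  continuous f -> measurable_fun setT f.
Proof.
move=> /continuousP cf; apply: (measurability _ (RGenOpens.measurableE R)).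
move=> _ [_ [a [b ->] <-]]; rewrite setTI; apply: open_measurable_row.
by apply: cf; exact: interval_open.
Qed.

End row_measure.

(** The slices of a cube are cubes or empty. *)
Lemma lebesgue_cube (R : realType) n (x : 'rV[R]_n) (r : R) : 0 < r ->
  lebesgue_row (cube x r) = ((r *+ 2) ^+ n)%:E.
Proof.
move=> r0; elim: n x => [|n IH] x.
  by rewrite /= diracE mem_set// => -[].
have slice (t : R) : [set y | cube x r (cons_row (t, y))] =
    if t \in (ball (x 0 0) r : set R) then cube (rsubmx (x : 'rV_(1 + n))) r else set0.
  have E0 y : cons_row (t, y) 0 0 = t.
    rewrite /cons_row mxE; case: splitP => [j _|//].
    by rewrite (ord1 j) mxE eqxx.
  have ES y i : cons_row (t, y) 0 (lift ord0 i) = y 0 i.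
    rewrite /cons_row mxE; case: splitP => [j /= |k [ik]].
      by rewrite (ord1 j).
    by congr (y 0 _); apply/val_inj.
  case: ifPn => [|tx]; [rewrite inE => tx|]; apply/seteqP; split => y //=.
  - move=> xy i; have := xy (lift ord0 i); rewrite ES mxE.
    by rewrite (_ : lift ord0 i = rshift 1 i)//; exact/val_inj.
  - move=> xy i; case: (unliftP ord0 i) => [j|] ->; last by rewrite E0.
    have := xy j; rewrite ES mxE.
    by rewrite (_ : lift ord0 j = rshift 1 j)//; exact/val_inj.
  - move=> xy; move/negP : tx; apply; rewrite inE /ball/=.
    by have := xy 0; rewrite E0.
rewrite -[LHS]/(\int[lebesgue_measure]_t
  lebesgue_row [set y | cube x r (cons_row (t, y))])%E.
transitivity (\int[lebesgue_measure]_t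
    (((r *+ 2) ^+ n)%:E * (\1_(ball (x 0 0) r : set R) t)%:E))%E.
  apply: eq_integral => t _; rewrite slice indicE.
  by case: ifPn => _; rewrite ?IH ?mule1 ?measure0 ?mule0.
have mball : measurable (ball (x 0 0) r : set (measurableTypeR R)).
  by rewrite ball_itv; exact: measurable_itv.
rewrite ge0_integralZl//.
- rewrite integral_indic ?setIT//.
  by rewrite [X in (_ * X)%E]lebesgue_measure_ball ?ltW// -EFinM exprSr.
- apply/measurable_EFinP; exact: measurable_indic.
- by rewrite lee_fin exprn_ge0// mulrn_wge0// ltW.
Qed.

Lemma lebesgue_open_gt0 (R : realType) n (U : set 'rV[R]_n) :
  open U -> U !=set0 -> (0 < lebesgue_row U)%E.
Proof.
move=> oU [x Ux].
have /nbhs_ballP[r /= r0 rU] : nbhs x U by exact: open_nbhs_nbhs.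
rewrite -cube_ball// in rU.
apply: (@lt_le_trans _ _ (lebesgue_row (cube x r))).
  by rewrite lebesgue_cube// lte_fin exprn_gt0// mulrn_wgt0.
apply: le_measure; rewrite ?inE//; first exact: measurable_cube.
exact: open_measurable_row.
Qed.

(** * Energy densities and their integrals *)

Section Rintegral_ae.
Context d (T : measurableType d) (R : realType).
Variables (mu : {measure set T -> \bar R}) (D : set T) (mD : measurable D).

Lemma ae_eq_Rintegral (f g : T -> R) :
  measurable_fun D f -> measurable_fun D g ->
  {ae mu, forall x, D x -> f x = g x} ->
  \int[mu]_(x in D) f x = \int[mu]_(x in D) g x.
Proof.
move=> mf mg fg; congr fine; apply: ae_eq_integral => //.
- exact/measurable_EFinP.
- exact/measurable_EFinP.
- by apply: filterS fg => x fg Dx; rewrite fg.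
Qed.

Lemma Rintegral_lin (c : R) (f g : T -> R) :
  mu.-integrable D (EFin \o f) -> mu.-integrable D (EFin \o g) ->
  \int[mu]_(x in D) (c * f x + g x) =
  c * \int[mu]_(x in D) f x + \int[mu]_(x in D) g x.
Proof.
move=> If Ig; rewrite RintegralD// ?RintegralZl//.
exact: (integrableZl mD c If).
Qed.

End Rintegral_ae.

Section admissible.
Context (R : realType) (d' : nat).
Let d := d'.+1.
Context (Omega : set 'rV[R]_d) (alpha beta : R) (A : 'rV[R]_d -> 'M[R]_d).
Hypothesis alpha0 : 0 <= alpha.
Hypothesis hA : admissible_coefficient Omega alpha beta A.
Let lambda := @lebesgue_row R d.

Lemma admissible_inner x : Omega x ->
  inner_on setT (fun g h => dotv (appmx (A x) g) h).
Proof.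
move=> Ox; have [_ _ /(_ _ Ox) AT /(_ _ Ox) Ab] := hA; split => //.
- move=> h _ c u v _ _.
  by rewrite /appmx mulmxDl -scalemxAl dotvDl dotvZl.
- by move=> u v _ _; rewrite dotv_appmx// dotvC.
- move=> u _; rewrite dotv_appmx//; have /andP[+ _] := Ab u.
  by apply: le_trans; rewrite mulr_ge0// sqr_ge0.
Qed.

Lemma admissible_bounds x g : Omega x ->
  alpha * dotv g g <= dotv (appmx (A x) g) g <= beta * dotv g g.
Proof.
move=> Ox; have [_ _ /(_ _ Ox) AT /(_ _ Ox) Ab] := hA.
by rewrite dotv_appmx// -enorm_sqr.
Qed.

(** The quadratic form of A x is nonnegative at g + h and at g - h. *)
Lemma admissible_dom x g h : Omega x ->
  `|dotv (appmx (A x) g) h| <= beta * (dotv g g + dotv h h).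
Proof.
move=> Ox; have ix := admissible_inner Ox.
have /andP[_ g1] := admissible_bounds g Ox.
have /andP[_ h1] := admissible_bounds h Ox.
have := inner_ge0 ix (u := g + h) I; have := inner_ge0 ix (u := g - h) I.
rewrite (inner_sqrB ix)// (inner_sqrD ix)// => m p.
have g0 := inner_ge0 ix (u := g) I; have h0 := inner_ge0 ix (u := h) I.
by rewrite ler_norml; apply/andP; split; lra.
Qed.

Variables (D : set 'rV[R]_d).
Hypotheses (oOmega : open Omega) (oD : open D) (DO : D `<=` Omega).
Let mD : measurable D := open_measurable_row oD.

Lemma L2_sqr_integrable (u : 'rV[R]_d -> R) : L2 u ->
  lambda.-integrable D (EFin \o (fun x => u x ^+ 2)).
Proof.
case=> mu u2; apply: (@integrableS _ _ _ _ setT) => //.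
apply/integrableP; split.
  by apply/measurable_EFinP; apply: measurable_funX.
apply: le_lt_trans u2; apply: ge0_le_integral => //.
- apply: measurableT_comp => //; apply/measurable_EFinP.
  exact: measurable_funX.
- by apply/measurable_EFinP; exact: measurable_funX.
- by move=> x _ /=; rewrite ger0_norm// sqr_ge0.
Qed.

Lemma dotv_integrable (g : 'rV[R]_d -> 'rV[R]_d) :
  (forall i, L2 (fun x => g x 0 i)) ->
  lambda.-integrable D (EFin \o (fun x => dotv (g x) (g x))).
Proof.
move=> Lg; have -> : EFin \o (fun x => dotv (g x) (g x)) =
    (fun x => \sum_(i < d) (EFin \o (fun x => (g x 0%R i ^+ 2)%R)) x)%E.
  apply/funext => x /=; rewrite dotvE -sumEFin.
  by apply: eq_bigr => i _ /=; rewrite expr2.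
by apply: integrable_sum => // i _; exact: L2_sqr_integrable.
Qed.

Lemma measurable_form (g h : 'rV[R]_d -> 'rV[R]_d) :
  (forall i, measurable_fun setT (fun x => g x 0 i)) ->
  (forall i, measurable_fun setT (fun x => h x 0 i)) ->
  measurable_fun D (fun x => dotv (appmx (A x) (g x)) (h x)).
Proof.
move=> mg mh; have [mA _ _ _] := hA.
have -> : (fun x => dotv (appmx (A x) (g x)) (h x)) =
    (fun x => \sum_(j < d) ((\sum_(i < d) (g x 0 i * A x j i)) * h x 0 j)).
  apply/funext => x; rewrite dotvE; apply: eq_bigr => j _.
  by rewrite mxE; congr (_ * _); apply: eq_bigr => i _; rewrite mxE.
have mT (f : 'rV[R]_d -> R) : measurable_fun setT f -> measurable_fun D f.
  exact: measurable_funTS.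
apply: measurable_sum => j; apply: measurable_funM; last exact: mT.
apply: measurable_sum => i; apply: measurable_funM; first exact: mT.
by apply: measurable_funS (mA j i) => //; exact: open_measurable_row.
Qed.

Lemma form_integrable (g h : 'rV[R]_d -> 'rV[R]_d) :
  (forall i, L2 (fun x => g x 0 i)) -> (forall i, L2 (fun x => h x 0 i)) ->
  lambda.-integrable D (EFin \o (fun x => dotv (appmx (A x) (g x)) (h x))).
Proof.
move=> Lg Lh.
apply: (@le_integrable _ _ _ _ _ mD _
  (fun x => beta%:E * ((dotv (g x) (g x))%:E + (dotv (h x) (h x))%:E))%E).
- apply/measurable_EFinP; apply: measurable_form => i.
    by have [] := Lg i.
  by have [] := Lh i.
- move=> x Dx /=; rewrite lee_fin; apply: le_trans (ler_norm _).
  exact: (admissible_dom _ _ (DO Dx)).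
- apply: integrableZl => //; apply: integrableD => //; exact: dotv_integrable.
Qed.

End admissible.

(** * The energy forms on the finite-element space *)

Section grad_linear.
Context (R : realType) (d' : nat).
Let d := d'.+1.
Implicit Types (u v : 'rV[R]_d -> R) (x : 'rV[R]_d).

Lemma gradP (c : R) u v x :
  (forall w, derivable u x w) -> (forall w, derivable v x w) ->
  grad (c *: u + v) x = c *: grad u x + grad v x.
Proof.
move=> du dv; apply/rowP => i; rewrite !mxE deriveD ?deriveZ//.
exact: derivableZ.
Qed.

Lemma grad0 x : grad (0 : 'rV[R]_d -> R) x = 0.
Proof. by apply/rowP => i; rewrite !mxE (derive_cst (0 : R)). Qed.

Lemma grad_near0 u x : (\near x, u x = 0) -> grad u x = 0.
Proof.
move=> u0; rewrite -(grad0 x); apply/rowP => i; rewrite !mxE.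
exact: near_eq_derive.
Qed.

Lemma derivable_near0 u x : (\near x, u x = 0) -> forall w, derivable u x w.
Proof.
move=> u0 w; apply: (@near_eq_derivable _ _ _ (cst 0)); last exact: derivable_cst.
by apply: filterS u0 => y ->.
Qed.

End grad_linear.

Section fe.
Context (R : realType) (d' : nat).
Let d := d'.+1.
Context (Omega : set 'rV[R]_d) (N : nat) (T : 'I_N -> set 'rV[R]_d).
Context (Vh : set ('rV[R]_d -> R)).
Hypotheses (oOmega : open Omega) (hT : is_mesh Omega T).
Hypothesis hV : conforming_fe_space Omega T Vh.
Let lambda := @lebesgue_row R d.

(** Finite-element functions are differentiable at these points, where pointwise
    gradients therefore add: they are smooth inside the elements, and vanish off
    the closure of the domain. *)
Definition regular_set : set 'rV[R]_d :=
  [set x | (exists i, T i x) \/ ~ closure Omega x].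

Lemma regular_ae : {ae lambda, forall x, regular_set x}.
Proof.
have [hTi _ hcov] := hT.
have : {ae lambda, forall x, forall i, ~ (closure (T i) `\` T i) x}.
  apply: filter_forall => i; exists (closure (T i) `\` T i).
  have [oTi _ _ _ ?] := hTi i; split => //.
    apply: measurableD; last exact: open_measurable_row.
    by apply: closed_measurable_row; exact: closed_closure.
  by move=> x /= /contrapT.
apply: filterS => x xT.
have [[i _ Ti]|nO] := pselect ((\bigcup_i closure (T i)) x); last first.
  by right; rewrite hcov.
by left; exists i; apply: contrapT => nT; exact: (xT i).
Qed.

Lemma fe_subspace : lin_subspace Vh.
Proof.
have [[m [b ->]] _ _] := hV; split.
  by exists (fun=> 0); apply/funext => x; rewrite big1// => i _; rewrite mul0r.
move=> c u v [cu ->] [cv ->]; exists (fun i => c * cu i + cv i).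
apply/funext => x; rewrite -[LHS]/(c * (\sum_(i < m) cu i * b i x) +
  \sum_(i < m) cv i * b i x) mulr_sumr -big_split/=.
by apply: eq_bigr => i _; rewrite mulrDl mulrA.
Qed.

Lemma fe_span : exists m (b : 'I_m -> 'rV[R]_d -> R),
  forall u, Vh u -> exists c : 'I_m -> R, u = \sum_(i < m) c i *: b i.
Proof.
have [[m [b ->]] _ _] := hV; exists m, b => u [c ->]; exists c.
by apply/funext => x; rewrite fct_sumE.
Qed.

Lemma fe_derivable u x : Vh u -> regular_set x -> forall w, derivable u x w.
Proof.
have [_ _ hVu] := hV => /hVu[cu u0 su] [[i Ti]|xO].
  by move=> w; apply: diff_derivable; exact: (su i [::] x Ti).
apply: derivable_near0.
have : \forall y \near x, ~ closure Omega y.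
  by apply: open_nbhs_nbhs; split => //; by apply: closed_openC; exact: closed_closure.
by apply: filterS => y yO; apply: u0 => /subset_closure.
Qed.

Lemma fe_grad_lin c u v x : Vh u -> Vh v -> regular_set x ->
  grad (c *: u + v) x = c *: grad u x + grad v x.
Proof.
by move=> Vu Vv Gx; rewrite gradP//; exact: fe_derivable.
Qed.

Lemma fe_grad_L2 u : Vh u -> forall i, L2 (fun x => grad u x 0 i).
Proof. by have [_ sub _] := hV => /sub[]. Qed.

Section form.
Context (alpha beta : R) (A : 'rV[R]_d -> 'M[R]_d).
Hypothesis alpha0 : 0 <= alpha.
Hypothesis hA : admissible_coefficient Omega alpha beta A.

Let q x g h := dotv (appmx (A x) g) h.

Lemma form_sym u v : form A Omega u v = form A Omega v u.
Proof.
apply: eq_Rintegral => x /[!inE] Ox.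
exact: (inner_sym (admissible_inner alpha0 hA Ox)).
Qed.

Lemma form_lin D u : open D -> D `<=` Omega -> Vh u ->
  linear_on Vh (form A D u).
Proof.
move=> oD DO Vu c v w Vv Vw; have mD := open_measurable_row oD.
have If f g : Vh f -> Vh g ->
    lambda.-integrable D (EFin \o (fun x => q x (grad f x) (grad g x))).
  move=> Vf Vg; apply: (form_integrable alpha0 hA oOmega oD DO).
    exact: fe_grad_L2.
  exact: fe_grad_L2.
rewrite -[RHS]Rintegral_lin//; try exact: If.
have Vcvw := fe_subspace.2 c v w Vv Vw.
apply: ae_eq_Rintegral => //.
- by have /measurable_int/measurable_EFinP := If _ _ Vu Vcvw.
- apply: measurable_funD; last by have /measurable_int/measurable_EFinP := If _ _ Vu Vw.
  apply: measurable_funM => //.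
  by have /measurable_int/measurable_EFinP := If _ _ Vu Vv.
- apply: filterS regular_ae => x Gx Dx; rewrite fe_grad_lin//.
  by rewrite (inner_linr (admissible_inner alpha0 hA (DO _ Dx))).
Qed.

Lemma form_inner : inner_on Vh (form A Omega).
Proof.
split.
- exact: fe_subspace.
- move=> u Vu c v w Vv Vw; rewrite form_sym [form _ _ v u]form_sym.
  by rewrite [form _ _ w u]form_sym; exact: form_lin.
- by move=> *; exact: form_sym.
- move=> u Vu; apply: Rintegral_ge0 => x Ox.
  exact: (inner_ge0 (admissible_inner alpha0 hA Ox)).
Qed.

Lemma norma_form u : norma A Omega u = Num.sqrt (form A Omega u u).
Proof.
congr Num.sqrt; apply: eq_Rintegral => x /[!inE] Ox.
have [_ _ /(_ _ Ox) AT /(_ _ Ox) Ab] := hA.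
rewrite enorm_sqrtmx// => xi; have /andP[+ _] := Ab xi; apply: le_trans.
by rewrite mulr_ge0// sqr_ge0.
Qed.

End form.

Lemma admissible1 : admissible_coefficient Omega 1 1 (fun=> 1%:M).
Proof.
split.
- by move=> i j; exact: measurable_cst.
- exists 1; apply/aeW => x _ i j; rewrite mxE.
  by case: (i == j); rewrite ?normr0 ?normr1.
- by move=> x _; exact: trmx1.
- move=> x _ xi; rewrite /appmx trmx1 mulmx1 enorm_sqr mul1r.
  by rewrite lexx.
Qed.

Lemma norm1_form u : norm1 Omega u = Num.sqrt (form (fun=> 1%:M) Omega u u).
Proof.
congr Num.sqrt; apply: eq_Rintegral => x _.
by rewrite enorm_sqr /appmx trmx1 mulmx1.
Qed.

Lemma form_bounds alpha beta A u : 0 <= alpha ->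
  admissible_coefficient Omega alpha beta A -> Vh u ->
  alpha * form (fun=> 1%:M) Omega u u <= form A Omega u u <=
  beta * form (fun=> 1%:M) Omega u u.
Proof.
move=> alpha0 hA Vu; have mO := open_measurable_row oOmega.
have L2u := fe_grad_L2 Vu.
have I1 := form_integrable ler01 admissible1 oOmega oOmega (@subset_refl _ _) L2u L2u.
have IA := form_integrable alpha0 hA oOmega oOmega (@subset_refl _ _) L2u L2u.
have Ic c : lambda.-integrable Omega
    (EFin \o (fun x => c * dotv (appmx 1%:M (grad u x)) (grad u x))).
  exact: (integrableZl mO c I1).
have E x : dotv (appmx 1%:M (grad u x)) (grad u x) = dotv (grad u x) (grad u x).
  by rewrite /appmx trmx1 mulmx1.
apply/andP; split; rewrite -RintegralZl//.
  apply: le_Rintegral => // x Ox; rewrite E.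
  by have /andP[] := admissible_bounds hA (grad u x) Ox.
apply: le_Rintegral => // x Ox; rewrite E.
by have /andP[] := admissible_bounds hA (grad u x) Ox.
Qed.

End fe.

(** * Definiteness of the energy *)

Section zero_gradient.
Context (R : realType) (d' : nat).
Let d := d'.+1.
Implicit Types (u : 'rV[R]_d -> R) (x y w : 'rV[R]_d).

Lemma derive_grad0 u x w : differentiable u x -> grad u x = 0 -> 'D_w u x = 0.
Proof.
move=> du g0; rewrite deriveE// [w]row_sum_delta linear_sum big1// => i _.
rewrite linearZ/= -deriveE//; move/rowP : g0 => /(_ i).
by rewrite !mxE => ->; rewrite scaler0.
Qed.

Lemma cst_segment u x y :
  (forall t : R, t \in `[0, 1] -> differentiable u (x + t *: (y - x)) /\
     grad u (x + t *: (y - x)) = 0) -> u y = u x.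
Proof.
move=> h; pose f (t : R) := u (x + t *: (y - x)).
have fD (t : R) : t \in `[0, 1] -> is_derive t (1 : R) f (0 : R).
  move=> t01; have [du g0] := h t t01.
  have E : (fun s : R => s^-1 *: ((f \o shift t) (s *: 1) - f t)) =
    (fun s => s^-1 *: ((u \o shift (x + t *: (y - x))) (s *: (y - x)) -
                       u (x + t *: (y - x)))).
    apply/funext => s; rewrite /f /= /shift/=; congr (_ *: (u _ - _)).
    by rewrite [s *: 1]mulr1 scalerDl addrCA addrA addrC addrA.
  have dt : derivable u (x + t *: (y - x)) (y - x) by exact: diff_derivable.
  rewrite /derivable -E in dt.
  apply: DeriveDef; first exact: dt.
  by rewrite /derive E -/(derive _ _ _) derive_grad0.
have fc : {within `[0, 1], continuous f}.
  by apply: derivable_within_continuous => t t01; have [] := fD t t01.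
have fD' (t : R) : t \in `]0, 1[ -> is_derive t (1 : R) f ((fun=> 0 : R) t).
  by move=> t01; apply: fD; exact: subset_itv_oo_cc.
have [c _] := MVT_segment ler01 fD' fc.
rewrite mul0r => /eqP; rewrite subr_eq0 /f scale1r scale0r addr0.
by rewrite [x + _]addrC subrK => /eqP.
Qed.

(** Near a point of an open set, balls are convex, so u is locally constant. *)
Lemma cst_connected u (D : set 'rV[R]_d) : open D -> connected D ->
  (forall x, D x -> differentiable u x /\ grad u x = 0) ->
  forall x y, D x -> D y -> u y = u x.
Proof.
move=> oD cD h x y Dx Dy.
have loc z z' r : D z -> ball z r `<=` D -> ball z r z' -> u z' = u z.
  move=> Dz rD zz'; apply: cst_segment => t /[!in_itv]/= /andP[t0 t1].
  apply: h; apply: rD; move: zz'; rewrite -!ball_normE/=.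
  rewrite opprD addNKr normrN normrZ ger0_norm//.
  apply: le_lt_trans; rewrite -[leRHS]mul1r -normrN opprB.
  exact: ler_wpM2r.
have ballD z : D z -> exists2 r, 0 < r & ball z r `<=` D.
  move=> Dz; have /nbhs_ballP[r /= r0 rD] : nbhs z D by exact: open_nbhs_nbhs.
  by exists r.
pose B := D `&` [set z | u z = u x].
suff BD : B = D by move: Dy; rewrite -BD => -[].
apply: cD.
- by exists x.
- exists B; last by rewrite setIA setIid.
  rewrite openE => z [Dz zx]; have [r r0 rD] := ballD _ Dz.
  apply/nbhs_ballP; exists r => //= z' zz'; split; first exact: rD.
  by rewrite /= (loc z z' r).
- exists (closure B); first exact: closed_closure.
  apply/seteqP; split => [z Bz|z [Dz cBz]].
    by split; [case: Bz|exact: subset_closure].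
  split => //; have [r r0 rD] := ballD _ Dz.
  have [z' [[Dz' z'x] zz']] := cBz _ (nbhsx_ballx z r r0).
  by rewrite /= -(loc z z' r).
Qed.

(** On a segment from x to a zero y, |u| would take half of its least nonzero
    value. *)
Lemma finite_range_zero u n (c : 'I_n -> R) y : continuous u -> u y = 0 ->
  (forall x, u x = 0 \/ exists i, u x = c i) -> forall x, u x = 0.
Proof.
move=> cu uy uc x; apply: contrapT => /eqP ux.
pose m := \big[Num.min/`|u x|]_(i | c i != 0) `|c i|.
have m0 : 0 < m by apply: lt_bigmin => [|i]; rewrite normr_gt0.
have mx : m <= `|u x| by exact: bigmin_le_id.
pose f (t : R) := `|u (y + t *: (x - y))|.
have cf : continuous (f : R -> R).
  move=> t; apply: cvg_norm.
  apply: (@continuous_comp _ _ _ (fun t : R => y + t *: (x - y)) u).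
    by apply: cvgD; [exact: cvg_cst|apply: cvgZr_tmp; exact: cvg_id].
  exact: cu.
have f0 : f 0 = 0 by rewrite /f scale0r addr0 uy normr0.
have f1 : f 1 = `|u x| by rewrite /f scale1r addrC subrK.
have [||t _ ft] := @IVT R f 0 1 (m / 2) ler01.
- exact: continuous_subspaceT.
- rewrite f0 f1 min_l// max_r//; lra.
have := uc (y + t *: (x - y)); rewrite -[u _ = 0]/(u _ = 0).
case => [z0|[i zi]]; move: ft; rewrite /f.
  by rewrite z0 normr0; lra.
rewrite zi; have [->|ci0] := eqVneq (c i) 0; first by rewrite normr0; lra.
have mc : m <= `|c i| by exact: (bigmin_le_cond _ (P := fun j => c j != 0)).
by lra.
Qed.

End zero_gradient.

Section definite.
Context (R : realType) (d' : nat).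
Let d := d'.+1.
Context (Omega : set 'rV[R]_d) (N : nat) (T : 'I_N -> set 'rV[R]_d).
Context (Vh : set ('rV[R]_d -> R)).
Hypotheses (oOmega : open Omega) (bOmega : bounded_set Omega).
Hypotheses (hT : is_mesh Omega T) (hV : conforming_fe_space Omega T Vh).
Let lambda := @lebesgue_row R d.

Lemma bounded_outside : exists y, ~ Omega y.
Proof.
have [M0 [_ MO]] := bOmega.
have {}MO := MO (M0 + 1) (ltr_pwDr ltr01 (lexx _)).
pose e : 'rV[R]_d := const_mx 1.
have e0 : `|e| != 0.
  by rewrite normr_eq0; apply/eqP => /rowP/(_ 0); rewrite !mxE => /eqP; rewrite oner_eq0.
exists (((`|M0| + 2) / `|e|) *: e) => /MO /=.
rewrite normrZ normrM normfV normr_id mulfVK// ger0_norm ?addr_ge0//.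
by have := ler_norm M0; lra.
Qed.

Lemma fe_differentiable i u x : Vh u -> T i x -> differentiable u x.
Proof. by have [_ _ h] := hV => /h[_ _ su] Tix; exact: (su i [::] x). Qed.

Lemma fe_grad_cvg i u x : Vh u -> T i x ->
  (fun y => dotv (grad u y) (grad u y)) @ x --> dotv (grad u x) (grad u x).
Proof.
have [_ _ h] := hV => /h[_ _ su] Tix.
under eq_fun do rewrite dotvE; rewrite dotvE.
have Fx : Filter (nbhs x) by exact: nbhs_filter.
apply: (cvg_big _ Fx) => [|j _]; first exact: add_continuous.
have cj : (fun y => grad u y 0 j) @ x --> grad u x 0 j.
  have -> : (fun y => grad u y 0 j) = iter_partial [:: j] u.
    by apply/funext => y; rewrite mxE.
  have -> : grad u x 0 j = iter_partial [:: j] u x by rewrite mxE.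
  by apply: differentiable_continuous; exact: (su i [:: j] x).
exact: cvgM.
Qed.

(** The gradient is continuous inside T i, and nonempty open sets have positive
    measure. *)
Lemma fe_zero_energy u : Vh u -> form (fun=> 1%:M) Omega u u = 0 ->
  forall i x, T i x -> grad u x = 0.
Proof.
move=> Vu u0 i x Tix; have mO := open_measurable_row oOmega.
have [hTi _ _] := hT; have [oT _ _ TO _] := hTi i.
have L2u := fe_grad_L2 hV Vu.
have I1 := dotv_integrable oOmega L2u.
pose g y := dotv (grad u y) (grad u y).
have g0 : {ae lambda, forall y, Omega y -> g y = 0}.
  have mg : measurable_fun Omega (EFin \o g) by exact: measurable_int I1.
  have : (\int[lambda]_(y in Omega) `|(EFin \o g) y|)%E = 0%E.
    transitivity (\int[lambda]_(y in Omega) (g y)%:E)%E.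
      apply: eq_integral => y _ /=; rewrite ger0_norm//; exact: dotvv_ge0.
    have gfin : (\int[lambda]_(y in Omega) (g y)%:E)%E \is a fin_num.
      exact: integrable_fin_num I1.
    rewrite -(fineK gfin); congr EFin; rewrite -[RHS]u0.
    by apply: eq_Rintegral => y _; rewrite /appmx trmx1 mulmx1.
  move/(ae_eq_integral_abs lambda mO mg); apply: filterS => y /[apply] /= -[].
  exact.
apply: dotvv_eq0; apply: contrapT => gx.
pose U := interior (T i `&` [set y | g y != 0]).
have Ux : U x.
  apply: filterI; first exact: open_nbhs_nbhs.
  have cg := fe_grad_cvg Vu Tix.
  apply: (cg [set t | t != 0]); apply: open_nbhs_nbhs; split.
    exact: open_neq.
  exact/eqP.
have oU : open U by exact: open_interior.
have := lebesgue_open_gt0 oU (ex_intro _ x Ux).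
case: g0 => M [mM M0 hM].
suff : (lambda U <= 0)%E by move=> /le_lt_trans /[apply]; rewrite ltxx.
rewrite -M0; apply: le_measure; rewrite ?inE//; first exact: open_measurable_row.
move=> y /interior_subset[Ty /eqP gy]; apply: hM => /= /(_ (TO _ Ty)).
exact: gy.
Qed.

(** Such a u is constant on each element, hence takes finitely many values, while
    it is continuous and vanishes off the bounded set Omega. *)
Lemma fe_definite u : Vh u -> form (fun=> 1%:M) Omega u u = 0 -> u = 0.
Proof.
move=> Vu u0; have g0 := fe_zero_energy Vu u0.
have [hTi _ hcov] := hT; have [_ _ /(_ _ Vu)[cu uO su]] := hV.
have [y Oy] := bounded_outside.
pose p i := xget 0 (T i).
have pT i : T i (p i).
  by have [_ _ [z Tz] _ _] := hTi i; exact: xgetPex (ex_intro _ z Tz).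
apply/funext => x.
apply: (@finite_range_zero _ _ u N (fun i => u (p i)) y) => //; first exact: uO.
move=> z; have [Oz|nOz] := pselect (Omega z); last by left; exact: uO.
have : closure Omega z by exact: subset_closure.
rewrite hcov => -[i _ cTz]; right; exists i.
have [oT cT _ _ _] := hTi i.
have clo : closed [set t | u t = u (p i)].
  apply: (@preimage_closed _ _ u [set u (p i)]) => [t _|]; first exact: cu.
  exact: closed_eq.
apply: clo; apply: closureS cTz => t Tt /=.
apply: (cst_connected oT cT) => // s Ts; split; first exact: fe_differentiable Ts.
exact: g0 Ts.
Qed.

End definite.

(** * Functions in H^1_0 of an open set *)

Section test_functions.
Context (R : realType) (d' : nat).
Let d := d'.+1.
Implicit Types (phi psi : 'rV[R]_d -> R) (w : set 'rV[R]_d).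

Lemma iter_partial_lin c phi psi s : smooth_on setT phi -> smooth_on setT psi ->
  iter_partial s (c *: phi + psi) = c *: iter_partial s phi + iter_partial s psi.
Proof.
move=> sphi spsi; elim: s => [//|i s IH].
rewrite -![iter_partial (i :: s) _]/('D_(delta_mx 0 i) (iter_partial s _)) IH.
apply/funext => x.
have dphi : differentiable (iter_partial s phi) x by exact: sphi.
have dpsi : differentiable (iter_partial s psi) x by exact: spsi.
rewrite deriveD ?deriveZ//; try exact: diff_derivable.
by apply: derivableZ; exact: diff_derivable.
Qed.

Lemma iter_partial0 s : iter_partial s (0 : 'rV[R]_d -> R) = 0.
Proof.
elim: s => [//|i s IH].
rewrite -![iter_partial (i :: s) _]/('D_(delta_mx 0 i) (iter_partial s _)) IH.
by apply/funext => x; rewrite (derive_cst (0 : R)).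
Qed.

Lemma test_fun0 w : test_fun w (0 : 'rV[R]_d -> R).
Proof.
split; first by move=> s x _; rewrite iter_partial0; exact: differentiable_cst.
by exists set0; split => //; exact: compact0.
Qed.

Lemma test_fun_lin w c phi psi :
  test_fun w phi -> test_fun w psi -> test_fun w (c *: phi + psi).
Proof.
move=> [sphi [K [cK Kw phi0]]] [spsi [L [cL Lw psi0]]]; split.
  move=> s x _; rewrite iter_partial_lin//.
  apply: differentiableD; last exact: spsi.
  by apply: differentiableZ; exact: sphi.
exists (K `|` L); split; first exact: compactU.
  by rewrite subUset.
move=> x /not_orP[nK nL].
by rewrite -[LHS]/(c * phi x + psi x) phi0// psi0// mulr0 addr0.
Qed.

Lemma test_fun_measurable w phi : test_fun w phi -> measurable_fun setT phi.
Proof.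
move=> [sphi _]; apply: continuous_measurable_row => x.
by apply: differentiable_continuous; exact: (sphi [::] x).
Qed.

Lemma test_fun_grad_measurable w phi i : test_fun w phi ->
  measurable_fun setT (fun x => grad phi x 0 i).
Proof.
move=> [sphi _]; apply: continuous_measurable_row.
rewrite (_ : (fun x => _) = iter_partial [:: i] phi).
  by move=> x; apply: differentiable_continuous; exact: (sphi [:: i] x).
by apply/funext => x; rewrite mxE.
Qed.

Lemma test_fun_derivable w phi x e : test_fun w phi -> derivable phi x e.
Proof. by move=> [sphi _]; apply: diff_derivable; exact: (sphi [::] x). Qed.

Lemma test_fun_grad_out w phi x : test_fun w phi -> ~ w x -> grad phi x = 0.
Proof.
move=> [_ [K [cK Kw phi0]]] nwx; apply: grad_near0.
have : \forall y \near x, ~ K y.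
  apply: open_nbhs_nbhs; split; last by move/Kw.
  by apply: closed_openC; apply: compact_closed => //; exact: norm_hausdorff.
by apply: filterS => y; exact: phi0.
Qed.

End test_functions.

Section integrals.
Context (R : realType) (d' : nat).
Let d := d'.+1.
Let lambda := @lebesgue_row R d.

Lemma measurable_enorm_sub (g h : 'rV[R]_d -> 'rV[R]_d) :
  (forall i, measurable_fun setT (fun x => g x 0 i)) ->
  (forall i, measurable_fun setT (fun x => h x 0 i)) ->
  measurable_fun setT (fun x => (enorm (g x - h x) ^+ 2)%:E).
Proof.
move=> mg mh; apply/measurable_EFinP.
under eq_fun do rewrite enorm_sqr dotvE.
apply: measurable_sum => i; under eq_fun do rewrite !mxE.
by apply: measurable_funM; apply: measurable_funB.
Qed.

Lemma measurable_sqr_sub (f g : 'rV[R]_d -> R) :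
  measurable_fun setT f -> measurable_fun setT g ->
  measurable_fun setT (fun x => ((f x - g x) ^+ 2)%:E).
Proof.
move=> mf mg; apply/measurable_EFinP; apply: measurable_funX.
exact: measurable_funB.
Qed.

(** Stability of L^2 limits under linear combinations, through
    |c a + b|^2 <= 2 c^2 |a|^2 + 2 |b|^2. *)
Lemma cvg_integral_lin (c : R) (F G H : nat -> 'rV[R]_d -> R) :
  (forall n x, 0 <= F n x) -> (forall n x, 0 <= G n x) ->
  (forall n x, 0 <= H n x) ->
  (forall n, measurable_fun setT (EFin \o F n)) ->
  (forall n, measurable_fun setT (EFin \o G n)) ->
  (forall n, measurable_fun setT (EFin \o H n)) ->
  (forall n, {ae lambda, forall x, H n x <= 2 * c ^+ 2 * F n x + 2 * G n x}) ->
  (\int[lambda]_x (F n x)%:E)%E @[n --> \oo] --> 0%E ->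
  (\int[lambda]_x (G n x)%:E)%E @[n --> \oo] --> 0%E ->
  (\int[lambda]_x (H n x)%:E)%E @[n --> \oo] --> 0%E.
Proof.
move=> F0 G0 H0 mF mG mH HFG cF cG.
pose K n := ((2 * c ^+ 2)%:E * \int[lambda]_x (F n x)%:E +
             2%:E * \int[lambda]_x (G n x)%:E)%E.
have c2 : 0 <= 2 * c ^+ 2 by rewrite mulr_ge0// sqr_ge0.
have cK : K n @[n --> \oo] --> 0%E.
  have -> : 0%E = ((2 * c ^+ 2)%:E * 0 + 2%:E * 0 :> \bar R)%E.
    by rewrite !mule0 adde0.
  by apply: cvgeD; [rewrite !mule0|exact: cvgeZl..].
apply: (squeeze_cvge _ (cvg_cst 0%E) cK); apply: nearW => n.
rewrite integral_ge0 /=; last by move=> x _; rewrite lee_fin.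
rewrite /K -!ge0_integralZl//; try (by move=> x _; rewrite lee_fin).
rewrite -ge0_integralD//.
- apply: ae_ge0_le_integral => //.
  + by move=> x _; rewrite lee_fin.
  + exact: mH.
  + by move=> x _; rewrite adde_ge0 ?mule_ge0// lee_fin.
  + apply: emeasurable_funD; apply: measurable_funeM.
      exact: mF.
    exact: mG.
  + apply: filterS (HFG n) => x h _.
    by rewrite -!EFinM -EFinD lee_fin.
- by move=> x _; rewrite mule_ge0// lee_fin.
- by apply: measurable_funeM; exact: mF.
- by move=> x _; rewrite mule_ge0// lee_fin.
- by apply: measurable_funeM; exact: mG.
- exact: mG.
- exact: mF.
Qed.

End integrals.

Section H10_linear.
Context (R : realType) (d' : nat).
Let d := d'.+1.
Context (Omega : set 'rV[R]_d) (N : nat) (T : 'I_N -> set 'rV[R]_d).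
Context (Vh : set ('rV[R]_d -> R)).
Hypotheses (hT : is_mesh Omega T) (hV : conforming_fe_space Omega T Vh).
Let lambda := @lebesgue_row R d.

Let fe_L2 u : Vh u -> L2 u.
Proof. by have [_ sub _] := hV => /sub[]. Qed.

Lemma H10_0 w : H10 w (0 : 'rV[R]_d -> R).
Proof.
have V0 := (fe_subspace hV).1.
split; [exact: fe_L2|exact: (fe_grad_L2 hV)|].
exists (fun=> 0); split => [n||]; first exact: test_fun0.
  apply: cvg_near_cst; apply: nearW => n; apply: integral0_eq => x _.
  by rewrite subrr expr0n/=.
apply: cvg_near_cst; apply: nearW => n; apply: integral0_eq => x _.
by rewrite subrr enorm_sqr /dotv mul0mx mxE.
Qed.

Lemma sqrD_le (c a b : R) : (c * a + b) ^+ 2 <= 2 * c ^+ 2 * a ^+ 2 + 2 * b ^+ 2.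
Proof. by have := sqr_ge0 (c * a - b); lra. Qed.

Lemma enormD_le (c : R) (x y : 'rV[R]_d) :
  enorm (c *: x + y) ^+ 2 <= 2 * c ^+ 2 * enorm x ^+ 2 + 2 * enorm y ^+ 2.
Proof.
rewrite !enorm_sqr !dotvE !mulr_sumr -big_split/=; apply: ler_sum => i _.
by rewrite !mxE -!expr2; exact: sqrD_le.
Qed.

(** Gradients add almost everywhere, so that the combination of approximating
    sequences approximates the combination. *)
Lemma H10_lin w c u v : Vh u -> Vh v -> H10 w u -> H10 w v -> H10 w (c *: u + v).
Proof.
move=> Vu Vv [L2u L2gu [phi [tphi phiu gphiu]]] [L2v L2gv [psi [tpsi psiv gpsiv]]].
have Vs := (fe_subspace hV).2 c u v Vu Vv.
have mS n := test_fun_lin c (tphi n) (tpsi n).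
have mu (f : 'rV[R]_d -> R) : L2 f -> measurable_fun setT f by case.
split; [exact: fe_L2|exact: (fe_grad_L2 hV)|].
exists (fun n => c *: phi n + psi n); split; first exact: mS.
  apply: (cvg_integral_lin (c := c)
    (F := fun n x => (phi n x - u x) ^+ 2)
    (G := fun n x => (psi n x - v x) ^+ 2)) => //; try (by move=> *; exact: sqr_ge0).
  - move=> n; apply: measurable_sqr_sub; last exact: mu.
    exact: test_fun_measurable (tphi n).
  - move=> n; apply: measurable_sqr_sub; last exact: mu.
    exact: test_fun_measurable (tpsi n).
  - move=> n; apply: measurable_sqr_sub; last by apply: mu; exact: fe_L2 Vs.
    exact: test_fun_measurable (mS n).
  - move=> n; apply: aeW => x.
    rewrite (_ : _ - _ = c * (phi n x - u x) + (psi n x - v x)).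
      exact: sqrD_le.
    by rewrite -[LHS]/((c * phi n x + psi n x) - (c * u x + v x)); ring.
apply: (@cvg_integral_lin _ _ c
  (fun n x => enorm (grad (phi n) x - grad u x) ^+ 2)
  (fun n x => enorm (grad (psi n) x - grad v x) ^+ 2)
  (fun n x => enorm (grad (c *: phi n + psi n) x - grad (c *: u + v) x) ^+ 2)
  _ _ _ _ _ _ _ gphiu gpsiv); try by move=> n x; exact: sqr_ge0.
- move=> n; apply: measurable_enorm_sub => i; last by apply: mu; exact: L2gu.
  exact: test_fun_grad_measurable (tphi n).
- move=> n; apply: measurable_enorm_sub => i; last by apply: mu; exact: L2gv.
  exact: test_fun_grad_measurable (tpsi n).
- move=> n; apply: measurable_enorm_sub => i; last by apply: mu; exact: (fe_grad_L2 hV Vs).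
  exact: test_fun_grad_measurable (mS n).
- move=> n; apply: filterS (regular_ae hT) => x Gx.
  rewrite gradP; [|by move=> e; exact: test_fun_derivable (tphi n)
                  |by move=> e; exact: test_fun_derivable (tpsi n)].
  rewrite (fe_grad_lin hV)//.
  rewrite (_ : _ - _ = c *: (grad (phi n) x - grad u x) +
    (grad (psi n) x - grad v x)); first exact: enormD_le.
  by rewrite scalerBr opprD addrACA.
Qed.

(** The gradients of the test functions vanish off w, so there |grad u|^2 is
    bounded in mean by the approximation errors. *)
Lemma H10_support w u : open w -> H10 w u ->
  {ae lambda, forall x, ~ w x -> grad u x = 0}.
Proof.
move=> ow [_ L2gu [phi [tphi _ gphiu]]].
have mw : measurable (~` w) by apply: measurableC; exact: open_measurable_row.
pose g x := (enorm (grad u x) ^+ 2)%:E.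
have mgu i : measurable_fun setT (fun x => grad u x 0 i) by case: (L2gu i).
have mg : measurable_fun setT g.
  apply/measurable_EFinP; under eq_fun do rewrite enorm_sqr dotvE.
  by apply: measurable_sum => i; exact: measurable_funM.
have mg' : measurable_fun (~` w) g by exact: measurable_funTS.
have gle0 : (\int[lambda]_(x in ~` w) g x <= 0)%E.
  apply: (cvge_ge _ gphiu); apply: nearW => n.
  have mG : measurable_fun setT
      (fun x => (enorm (grad (phi n) x - grad u x) ^+ 2)%:E).
    apply: measurable_enorm_sub => i //.
    exact: test_fun_grad_measurable (tphi n).
  apply: (@le_trans _ _ (\int[lambda]_(x in ~` w)
      (enorm (grad (phi n) x - grad u x) ^+ 2)%:E)%E).
    rewrite le_eqVlt; apply/orP; left; apply/eqP; apply: eq_integral => x.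
    rewrite inE => nwx; rewrite (test_fun_grad_out (tphi n) nwx) /g !enorm_sqr.
    by rewrite sub0r -scaleN1r dotvZl dotvC dotvZl mulrA mulrNN !mul1r.
  apply: ge0_subset_integral => //.
  by move=> x _; rewrite lee_fin sqr_ge0.
have : (\int[lambda]_(x in ~` w) `|g x| = 0)%E.
  apply/eqP; rewrite eq_le integral_ge0 ?andbT; last by move=> x _; exact: abse_ge0.
  apply: le_trans gle0; rewrite le_eqVlt; apply/orP; left; apply/eqP.
  by apply: eq_integral => x _; rewrite gee0_abs// lee_fin sqr_ge0.
move/(ae_eq_integral_abs lambda mw mg'); apply: filterS => x /[apply] -[].
by rewrite enorm_sqr => /dotvv_eq0.
Qed.

End H10_linear.

(** * Overlap of the patches *)

Section patches.
Context (R : realType) (d' : nat).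
Let d := d'.+1.
Context (Omega : set 'rV[R]_d) (N : nat) (T : 'I_N -> set 'rV[R]_d).
Hypothesis hT : is_mesh Omega T.

Lemma patch_open k i : open (patch T k (T i)).
Proof.
by have [hTi _ _] := hT; case: k => [|k] /=; [case: (hTi i)|exact: open_interior].
Qed.

Lemma sub_patch k i : T i `<=` patch T k (T i).
Proof.
have [hTi _ _] := hT; have [oT _ [p Tp] _ _] := hTi i.
elim: k => [//|k IH] x Tx /=; apply: filterS (open_nbhs_nbhs (conj oT Tx)) => y Ty.
apply: subset_closure; exists i => //=.
by exists p; split; apply: subset_closure => //; exact: IH.
Qed.

Lemma card_le_C_ovl k (S : {set 'I_N}) x : Omega x ->
  (forall i, i \in S <-> patch T k (T i) x) -> (#|S| <= C_ovl Omega T k)%N.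
Proof.
move=> Ox Sx; apply: (leq_bigmax_cond (F := fun S : {set _} => #|S|) S).
by apply/asboolP; exists x.
Qed.

(** An element lies in its own patch; this makes the stabilization parameter
    positive. *)
Lemma C_ovl_gt0 k : Omega !=set0 -> (0 < C_ovl Omega T k)%N.
Proof.
move=> [y Oy]; have [hTi _ hcov] := hT.
have : closure Omega y by exact: subset_closure.
rewrite hcov => -[i _ _]; have [_ _ [x Tx] TO _] := hTi i.
pose S := [set j | `[< patch T k (T j) x >]]%SET.
have SP j : j \in S <-> patch T k (T j) x.
  by rewrite inE; split => /asboolP.
apply: leq_trans (card_le_C_ovl (TO _ Tx) SP).
by apply/card_gt0P; exists i; apply/SP/sub_patch.
Qed.

End patches.

(** In the expansion of the left-hand side, a (h i, h j) vanishes unless i and j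
    are both in A, and is at most the mean of a (h i, h i) and a (h j, h j). *)
Lemma inner_sum_overlap (R : realType) (F : lmodType R) (S : set F)
    (a : F -> F -> R) n (h : 'I_n -> F) (A : {set 'I_n}) :
  inner_on S a -> (forall i, S (h i)) -> (forall i, i \notin A -> h i = 0) ->
  a (\sum_i h i) (\sum_i h i) <= #|A|%:R * \sum_i a (h i) (h i).
Proof.
move=> ia Sh hA; have sS := inner_sub ia.
pose s i : R := (i \in A)%:R.
have s0 i : 0 <= s i by exact: ler0n.
have aij i j : a (h i) (h j) <= (s j * a (h i) (h i) + s i * a (h j) (h j)) / 2.
  have ii := inner_ge0 ia (Sh i); have jj := inner_ge0 ia (Sh j).
  rewrite /s; have [iA|iA] := boolP (i \in A); last first.
    rewrite (hA i iA) !(linear_on0 sS (inner_lin ia _))//; last exact: sS.1.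
    by rewrite mulr0 mul0r addr0 mul0r.
  have [jA|jA] := boolP (j \in A); last first.
    rewrite (hA j jA) !(linear_on0 sS (inner_linr ia _))//; last exact: sS.1.
    by rewrite mulr0 mul0r addr0 mul0r.
  have := inner_ge0 ia (subspaceB sS (Sh i) (Sh j)).
  by rewrite (inner_sqrB ia)// ?mul1r; lra.
have SH : S (\sum_i h i) by exact: subspace_sum.
rewrite (linear_on_sum sS (inner_linr ia SH))//.
under eq_bigr do rewrite (linear_on_sum sS (inner_lin ia (Sh _)))//.
have sE : \sum_i s i = #|A|%:R.
  by rewrite -natr_sum -sum1_card [in RHS]big_mkcond.
apply: le_trans (ler_sum _ (fun i _ => ler_sum _ (fun j _ => aij j i))) _.
under eq_bigr => i _.
  rewrite -mulr_suml big_split/= -mulr_sumr -mulr_suml sE.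
  over.
rewrite -mulr_suml big_split/= -mulr_suml -mulr_sumr sE.
by rewrite le_eqVlt; apply/orP; left; apply/eqP; field.
Qed.

Section overlap.
Context (R : realType) (d' : nat).
Let d := d'.+1.
Context (Omega : set 'rV[R]_d) (Nh : nat) (Th : 'I_Nh -> set 'rV[R]_d).
Context (Vh : set ('rV[R]_d -> R)) (N : nat) (T : 'I_N -> set 'rV[R]_d).
Hypotheses (oOmega : open Omega) (hTh : is_mesh Omega Th).
Hypotheses (hV : conforming_fe_space Omega Th Vh) (hT : is_mesh Omega T).
Context (alpha beta : R) (A : 'rV[R]_d -> 'M[R]_d).
Hypotheses (alpha0 : 0 <= alpha) (hA : admissible_coefficient Omega alpha beta A).
Let lambda := @lebesgue_row R d.

Lemma fe_grad_sum n (f : 'I_n -> 'rV[R]_d -> R) x : (forall i, Vh (f i)) ->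
  regular_set Omega Th x -> grad (\sum_i f i) x = \sum_i grad (f i) x.
Proof.
move=> Vf Gx; apply/rowP => j; rewrite summxE.
apply: (linear_on_sum (fe_subspace hV) (l := fun u => grad u x 0 j)) => //.
by move=> c u v Vu Vv; rewrite (fe_grad_lin hV)// !mxE.
Qed.

(** At almost every point, the nonzero gradients are among those of the functions
    whose patches contain the point. *)
Lemma form_overlap k (f : 'I_N -> 'rV[R]_d -> R) :
  (forall i, Vh (f i)) -> (forall i, H10 (patch T k (T i)) (f i)) ->
  form A Omega (\sum_i f i) (\sum_i f i) <=
  (C_ovl Omega T k)%:R * \sum_i form A Omega (f i) (f i).
Proof.
move=> Vf Hf; have mO := open_measurable_row oOmega.
have IA u v : Vh u -> Vh v -> lambda.-integrable Omega
    (EFin \o (fun x => dotv (appmx (A x) (grad u x)) (grad v x))).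
  move=> Vu Vv; apply: (form_integrable alpha0 hA oOmega oOmega) => //.
    exact: (fe_grad_L2 hV).
  exact: (fe_grad_L2 hV).
have Vs : Vh (\sum_i f i) by exact: subspace_sum (fe_subspace hV) _ _ Vf.
pose q u x := dotv (appmx (A x) (grad u x)) (grad u x).
set C : R := (C_ovl Omega T k)%:R.
have Isum : lambda.-integrable Omega (EFin \o (fun x => \sum_i q (f i) x)).
  have -> : EFin \o (fun x => \sum_i q (f i) x) =
      (fun x => \sum_i (EFin \o q (f i)) x)%E.
    by apply/funext => x /=; rewrite sumEFin.
  by apply: integrable_sum => // i _; exact: IA.
have sumE : \sum_i form A Omega (f i) (f i) =
    \int[lambda]_(x in Omega) \sum_i q (f i) x.
  rewrite /Rintegral; under [in RHS]eq_integral do rewrite -sumEFin.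
  rewrite integral_sum//; last by move=> i; exact: IA.
  rewrite -sum_fine//.
  by move=> i _; apply: integrable_fin_num => //; exact: IA.
have IC : lambda.-integrable Omega (EFin \o (fun x => C * \sum_i q (f i) x)).
  exact: (integrableZl mO C Isum).
rewrite sumE -RintegralZl//.
apply: fine_le; [exact: integrable_fin_num (IA _ _ Vs Vs)|
  exact: integrable_fin_num IC|].
have q0 u x : Omega x -> 0 <= q u x.
  by move=> Ox; exact: (inner_ge0 (admissible_inner alpha0 hA Ox)).
apply: ae_ge0_le_integral => //.
- by move=> x Ox; rewrite lee_fin; exact: q0.
- exact: measurable_int (IA _ _ Vs Vs).
- move=> x Ox; rewrite lee_fin mulr_ge0// sumr_ge0// => i _; exact: q0.
- exact: measurable_int IC.
have supp : {ae lambda, forall x, forall i, ~ patch T k (T i) x -> grad (f i) x = 0}.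
  apply: filter_forall => i.
  have oP : open (patch T k (T i)) by exact: (patch_open hT).
  exact: (H10_support oP (Hf i)).
apply: filterS2 (regular_ae hTh) supp => x Gx gx Ox; rewrite lee_fin.
rewrite fe_grad_sum//.
pose S := [set j | `[< patch T k (T j) x >]]%SET.
have SP j : j \in S <-> patch T k (T j) x.
  by rewrite inE; split => /asboolP.
apply: le_trans (inner_sum_overlap (A := S) (admissible_inner alpha0 hA Ox) _ _) _ => //.
  by move=> i /negP iS; apply: gx => /SP.
rewrite ler_wpM2r//; first by apply: sumr_ge0 => i _; exact: q0.
by rewrite ler_nat; exact: card_le_C_ovl SP.
Qed.

End overlap.

(** * The localized orthogonal decomposition *)

Section lod.
Context (R : realType) (d' : nat).
Let d := d'.+1.
Let F := 'rV[R]_d -> R.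
Context (Omega : set 'rV[R]_d) (Nh NH : nat) (Th : 'I_Nh -> set 'rV[R]_d)
  (TH : 'I_NH -> set 'rV[R]_d) (Vh : set F) (IH : F -> F) (C_IH : R) (k : nat).
Context (A : 'rV[R]_d -> 'M[R]_d) (alpha beta : R).
Hypotheses (oOmega : open Omega) (bOmega : bounded_set Omega) (Omega0 : Omega !=set0).
Hypotheses (alpha0 : 0 < alpha) (alpha_beta : alpha <= beta).
Hypothesis hA : admissible_coefficient Omega alpha beta A.
Hypotheses (hTh : is_mesh Omega Th) (hTH : is_mesh Omega TH).
Hypothesis hVh : conforming_fe_space Omega Th Vh.
Hypothesis hIH : interpolation Omega Vh (coarse_space Omega TH Vh) C_IH IH.

Let a := form A Omega.
Let b := form (fun=> 1%:M) Omega.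
Let aT i := form A (TH i).
Let VH := coarse_space Omega TH Vh.
Let Vf := fine_space TH Vh IH k.
Let Q := corrector_T Omega TH Vh IH k A.
Let C : R := (C_ovl Omega TH k)%:R.

Let sVh : lin_subspace Vh := fe_subspace hVh.
Let ia : inner_on Vh a := form_inner oOmega hTh hVh (ltW alpha0) hA.
Let ib : inner_on Vh b := form_inner oOmega hTh hVh ler01 (admissible1 Omega).

Let VHVh : VH `<=` Vh. Proof. by move=> u []. Qed.
Let VfVh i : Vf i `<=` Vh. Proof. by move=> u []. Qed.

Let a_ge u : Vh u -> alpha * b u u <= a u u.
Proof. by move=> Vu; have /andP[] := form_bounds oOmega hVh (ltW alpha0) hA Vu. Qed.

Let a_le u : Vh u -> a u u <= beta * b u u.
Proof. by move=> Vu; have /andP[] := form_bounds oOmega hVh (ltW alpha0) hA Vu. Qed.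

Let b_def u : Vh u -> b u u = 0 -> u = 0.
Proof. by move=> Vu; apply: (fe_definite oOmega bOmega hTh hVh Vu). Qed.

Let a_def u : Vh u -> a u u = 0 -> u = 0.
Proof.
move=> Vu u0; apply: b_def => //; apply/eqP.
rewrite eq_le (inner_ge0 ib)// andbT -(pmulr_rle0 _ alpha0) -u0.
exact: a_ge.
Qed.

Lemma coarse_subspace : lin_subspace VH.
Proof.
have cV u : Vh u -> {within closure Omega, continuous u}.
  by have [_ _ h] := hVh => /h[cu _ _]; exact: continuous_subspaceT.
split.
  split; [exact: sVh.1|split; first exact/cV/sVh.1].
  by move=> i; exists 0, 0 => x _; rewrite /dotv mul0mx mxE addr0.
move=> c u v [Vu [_ Pu]] [Vv [_ Pv]].
have Vs := sVh.2 c u v Vu Vv; split => //; split; first exact: cV.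
move=> i; have [e1 [c1 E1]] := Pu i; have [e2 [c2 E2]] := Pv i.
exists (c *: e1 + e2), (c * c1 + c2) => x Tx.
rewrite -[LHS]/(c * u x + v x) E1// E2// dotvDl dotvZl; ring.
Qed.

Let sKer : lin_subspace [set u | Vh u /\ IH u = 0].
Proof.
have [_ linIH _ _] := hIH; split.
  split; first exact: sVh.1.
  have := linIH 1 0 0 sVh.1 sVh.1; rewrite !scale1r addr0 => /esym/eqP.
  by rewrite -subr_eq0 addrK => /eqP.
move=> c u v [Vu u0] [Vv v0]; split; first exact: sVh.2.
by rewrite linIH// u0 v0 scaler0 addr0.
Qed.

Lemma fine_subspace i : lin_subspace (Vf i).
Proof.
split; first by have [V0 IH0] := sKer.1; split => //; exact: (H10_0 hVh).
move=> c u v [Vu u0 Hu] [Vv v0 Hv].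
have [Vs s0] := sKer.2 c u v (conj Vu u0) (conj Vv v0).
by split; [exact: Vs|exact: s0|exact: (H10_lin hTh hVh _ Vu Vv Hu Hv)].
Qed.

Let VH_Vf uH uf : VH uH -> (forall i, Vf i (uf i)) ->
  uH = \sum_(i < NH) uf i -> uH = 0.
Proof.
move=> VuH Vuf E; have [_ _ proj _] := hIH; rewrite -(proj _ VuH) E.
have [] // : [set u | Vh u /\ IH u = 0] (\sum_(i < NH) uf i).
by apply: subspace_sum sKer _ _ _ => i; have [] := Vuf i.
Qed.

Let overlap uf : (forall i, Vf i (uf i)) ->
  a (\sum_(i < NH) uf i) (\sum_(i < NH) uf i) <= C * \sum_(i < NH) a (uf i) (uf i).
Proof.
move=> Vuf; apply: (form_overlap oOmega hTh hVh hTH (ltW alpha0) hA) => i.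
  by have [] := Vuf i.
by have [] := Vuf i.
Qed.

(** Existence for the corrector problem on a patch, so that the chosen value is a
    solution. *)
Lemma corrector_TP i u : Vh u -> Vf i (Q i u) /\
  forall w, Vf i w -> a (Q i u) w = aT i u w.
Proof.
move=> Vu; apply: (xgetPex 0 (P := [set q | Vf i q /\
  forall w, Vf i w -> a q w = aT i u w])).
have [m [e spanV]] := fe_span hVh.
have [hTi _ _] := hTH; have [oT _ _ TO _] := hTi i.
have [q Vq qP] := riesz_finite (l := aT i u)
    (fun v (Vv : Vf i v) => spanV v (VfVh Vv))
    (sub_inner (fine_subspace i) (@VfVh i) ia)
    (fun v (Vv : Vf i v) => a_def (VfVh Vv))
    (fun c v w (Vv : Vf i v) (Vw : Vf i w) =>
       form_lin oOmega hTh hVh (ltW alpha0) hA oT TO Vu c (VfVh Vv) (VfVh Vw)).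
by exists q.
Qed.

Let VfQ i u : VH u -> Vf i (Q i u).
Proof. by move=> /VHVh /(corrector_TP i)[]. Qed.

Let aQ i u w : VH u -> Vf i w -> a (Q i u) w = aT i u w.
Proof. by move=> /VHVh /(corrector_TP i)[_]; apply. Qed.

Let Q0 i : Q i 0 = 0.
Proof.
have VQ := VfQ i coarse_subspace.1.
apply: a_def; first exact: VfVh VQ.
rewrite aQ//; last exact: coarse_subspace.1.
rewrite /aT /Defs.form.
under eq_Rintegral do rewrite grad0 /appmx mul0mx /dotv mul0mx mxE.
by rewrite Rintegral_cst ?mul0r//; apply: open_measurable_row; have [/(_ i)[]] := hTH.
Qed.

Let C1 : 1 <= C.
Proof. by rewrite ler1n; exact: C_ovl_gt0 hTH _ Omega0. Qed.

Let rho := C * (beta / alpha).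
Let VV := two_scale_space Omega TH Vh IH k.

Let norm1E u : norm1 Omega u = Num.sqrt (b u u).
Proof. exact: norm1_form. Qed.

Let normaE u : norma A Omega u = Num.sqrt (a u u).
Proof. exact: (norma_form (ltW alpha0) hA). Qed.

Let norm1_sqr u : Vh u -> norm1 Omega u ^+ 2 = b u u.
Proof. by move=> Vu; rewrite norm1E sqr_sqrtr// (inner_ge0 ib). Qed.

Let norma_sqr u : Vh u -> norma A Omega u ^+ 2 = a u u.
Proof. by move=> Vu; rewrite normaE sqr_sqrtr// (inner_ge0 ia). Qed.

Lemma two_scale_quotientE u v : VV u -> VV v ->
  two_scale_quotient Omega TH Vh IH k A rho u v =
  tsform a aT alpha beta C u v /
    (tsnorma a Q alpha beta C u * tsnorm1 b v).
Proof.
move=> [u1 u2] [v1 v2].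
have Vz : Vh (u.1 - \sum_(i < NH) u.2 i).
  apply: (subspaceB sVh); first exact: VHVh.
  by apply: (subspace_sum sVh) => i; exact: VfVh (u2 i).
have Ve i : Vh (Q i u.1 - u.2 i).
  by apply: (subspaceB sVh); [exact/VfVh/VfQ|exact: VfVh (u2 i)].
have Ee : \sum_(i < NH) norma A Omega (Q i u.1 - u.2 i) ^+ 2 =
    \sum_(i < NH) a (Q i u.1 - u.2 i) (Q i u.1 - u.2 i).
  by apply: eq_bigr => i _; exact: norma_sqr (Ve i).
have Ev : \sum_(i < NH) norm1 Omega (v.2 i) ^+ 2 = \sum_(i < NH) b (v.2 i) (v.2 i).
  by apply: eq_bigr => i _; exact: norm1_sqr (VfVh (v2 i)).
have Na := congr1 Num.sqrt (congr2 +%R (norma_sqr Vz) (congr1 ( *%R rho) Ee)).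
have N1 := congr1 Num.sqrt (congr2 +%R (norm1_sqr (VHVh v1)) Ev).
exact: (congr2 (fun x y => tsform a aT alpha beta C u v / (x * y)) Na N1).
Qed.

Lemma two_scale_continuity :
  (sup_sup (VV `\ (0%R, 0%R)) (VV `\ (0%R, 0%R))
     (two_scale_quotient Omega TH Vh IH k A rho) <= (Num.sqrt beta)%:E)%E.
Proof.
apply: ge_ereal_sup => _ [u [VVu _] <-]; apply: ge_ereal_sup => _ [v [VVv _] <-].
rewrite lee_fin two_scale_quotientE//.
have := tsform_continuous ia ib alpha0 alpha_beta C1 a_le VHVh fine_subspace
  VfVh VfQ aQ VVu VVv.
set den := tsnorma _ _ _ _ _ _ * _.
have : 0 <= den by rewrite mulr_ge0 ?sqrtr_ge0.
rewrite le_eqVlt => /predU1P[<- _|den0]; first by rewrite invr0 mulr0 sqrtr_ge0.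
by rewrite ler_pdivrMr.
Qed.

(** A supremum that is at least gamma exceeds 24/25 gamma at some v.  As division
    by zero gives zero, a positive quotient has a nonzero denominator. *)
Lemma gamma_test (g : R) : 0 < g -> gamma Omega TH Vh IH k A = g%:E ->
  forall uH, VH uH -> uH <> 0 -> exists2 v, VH v &
  let w := uH - \sum_(i < NH) Q i uH in
  [/\ 0 < a w w, 0 < b v v & 24 / 25 * g *
    (Num.sqrt (a w w) * Num.sqrt (b v v)) <= a w v].
Proof.
move=> g0 gE uH VuH u0.
have glt : ((24 / 25 * g)%:E < gamma Omega TH Vh IH k A)%E.
  by rewrite gE lte_fin; lra.
have /(lt_le_trans glt) : (gamma Omega TH Vh IH k A <= ereal_sup
    [set (a (uH - corrector Omega TH Vh IH k A uH) v /
      (norma A Omega (uH - corrector Omega TH Vh IH k A uH) * norm1 Omega v))%:E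
      | v in VH `\ (0%R : F)])%E.
  by apply: ereal_inf_lbound; exists uH.
move=> /ereal_sup_gt[_ [v [Vv v0] <-]].
rewrite /corrector -/(Q _ _) lte_fin => lt_q; exists v => //=.
set w := uH - _ in lt_q *.
have Vw : Vh w.
  apply: (subspaceB sVh); first exact: VHVh.
  by apply: subspace_sum sVh _ _ _ => i; exact/VfVh/VfQ.
rewrite normaE norm1E in lt_q.
set D := Num.sqrt _ * Num.sqrt _ in lt_q *.
have D0 : 0 < D.
  have Dge0 : 0 <= D by rewrite mulr_ge0 ?sqrtr_ge0.
  rewrite lt_neqAle Dge0 andbT; apply/eqP => D0.
  by move: lt_q; rewrite -D0 invr0 mulr0; lra.
have factors_gt0 (x y : R) : 0 <= x -> 0 <= y -> 0 < x * y -> 0 < x /\ 0 < y.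
  move=> x0 y0 xy; split; rewrite lt_neqAle ?x0 ?y0 andbT; apply/eqP => E.
    by rewrite -E mul0r ltxx in xy.
  by rewrite -E mulr0 ltxx in xy.
have [sa sb] := factors_gt0 _ _ (sqrtr_ge0 _) (sqrtr_ge0 _) D0.
rewrite sqrtr_gt0 in sa; rewrite sqrtr_gt0 in sb.
have le_q := ltW lt_q; rewrite (ler_pdivlMr _ _ D0) in le_q.
by split; [exact: sa|exact: sb|exact: le_q].
Qed.

Lemma two_scale_inf_sup (g : R) : 0 < g -> g <= Num.sqrt alpha ->
  gamma Omega TH Vh IH k A = g%:E ->
  ((g / Num.sqrt 5)%:E <= inf_sup (VV `\ (0%R, 0%R)) (VV `\ (0%R, 0%R))
     (two_scale_quotient Omega TH Vh IH k A rho))%E.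
Proof.
move=> g0 g_le gE; apply: le_ereal_inf_tmp => _ [u [VVu u0] <-].
have [v [VVv v0 n10 h]] := tsform_infsup ia ib alpha0 alpha_beta C1 a_ge a_le
  b_def coarse_subspace VHVh fine_subspace VfVh VH_Vf overlap VfQ aQ Q0 g0 g_le
  (gamma_test g0 gE) VVu u0.
apply: le_trans (ereal_sup_ubound _); last by exists v.
rewrite lee_fin two_scale_quotientE// ler_pdivlMr// mulr_gt0//.
exact: (tsnorma_gt0 ia ib alpha0 alpha_beta C1 a_ge b_def VHVh fine_subspace
  VfVh VH_Vf VfQ Q0 VVu u0).
Qed.

End lod.

Theorem proposition4p6 (R : realType) (d p : nat)
    (P : set 'rV[R]_p) (Omega : set 'rV[R]_d.+1)
    (A : 'rV[R]_p -> 'rV[R]_d.+1 -> 'M[R]_d.+1) (alpha beta : R)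
    (hOmega : bounded_lipschitz_domain Omega)
    (h_alpha : 0 < alpha) (h_alpha_beta : alpha <= beta)
    (hA : forall mu, P mu -> admissible_coefficient Omega alpha beta (A mu))
    (Nh NH : nat) (Th : 'I_Nh -> set 'rV[R]_d.+1)
    (TH : 'I_NH -> set 'rV[R]_d.+1) (sigma : R)
    (hTh : is_mesh Omega Th) (hTh_reg : shape_regular sigma Th)
    (hTH : is_mesh Omega TH) (h_aligned : aligned Th TH)
    (Vh : set ('rV[R]_d.+1 -> R)) (hVh : conforming_fe_space Omega Th Vh)
    (hVH : coarse_space Omega TH Vh `\ 0 !=set0)
    (IH : ('rV[R]_d.+1 -> R) -> ('rV[R]_d.+1 -> R)) (C_IH : R)
    (hIH : interpolation Omega Vh (coarse_space Omega TH Vh) C_IH IH)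
    (k : nat)
    (mu : 'rV[R]_p) (hmu : P mu)
    (h_gamma_gt0 : (0 < gamma Omega TH Vh IH k (A mu))%E)
    (h_gamma_le : (gamma Omega TH Vh IH k (A mu) <= (Num.sqrt alpha)%:E)%E) :
  let rho := (C_ovl Omega TH k)%:R * (beta / alpha) in
  let VV := two_scale_space Omega TH Vh IH k `\ (0, 0) in
  let quotient := two_scale_quotient Omega TH Vh IH k (A mu) rho in
  (sup_sup VV VV quotient <= (Num.sqrt beta)%:E)%E /\
  (gamma Omega TH Vh IH k (A mu) * ((Num.sqrt 5)^-1)%:E <=
     inf_sup VV VV quotient)%E.
Proof.
move=> rho VV quotient; have [oO _ O0 bO _] := hOmega.
split; first exact: (two_scale_continuity k oO bO O0 h_alpha h_alpha_beta
  (hA _ hmu) hTh hTH hVh hIH).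
have gfin : gamma Omega TH Vh IH k (A mu) \is a fin_num.
  by rewrite fin_numE gt_eqF ?(lt_trans _ h_gamma_gt0)// lt_eqF//
    (le_lt_trans h_gamma_le)// ltry.
have gE := esym (fineK gfin).
rewrite gE -EFinM; apply: (two_scale_inf_sup (k := k) oO bO O0 h_alpha h_alpha_beta
  (hA _ hmu) hTh hTH hVh hIH) => //.
- by rewrite -lte_fin -gE.
- by rewrite -lee_fin -gE.
Qed.
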